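(* Let $\psi:\mathbb{N}\to\mathbb{R}^+$ be a function. Assume that $\psi$ is non-increasing, tends to $0$ at infinity, and that for every positive integer $c$ there exist positive real numbers $c_1<c_2$ such that $$ c_1\psi(\ell)\le\psi(c\,\ell)\le c_2\psi(\ell)\qquad\text{for all integers }\ell\ge 1. $$ (a) If $\sum_{\ell\ge 1}\psi(\ell)=+\infty$, then for almost all pairs $(\xi,y)\in\mathbb{R}^2$ (with respect to Lebesgue measure) there exist infinitely many primitive points $(p,q)$ such that $$ q\ge 1\quad\text{and}\quad |q\xi+p-y|\le\psi(q). $$ (b) If $\sum_{\ell\ge 1}\psi(\ell)$ converges, then the set of pairs $(\xi,y)\in\mathbb{R}^2$ for which there exist infinitely many primitive points $(p,q)$ with $q\ge 1$ and $|q\xi+p-y|\le\psi(q)$ has Lebesgue measure zero.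
   Context: $\mathbb{N}$ denotes the set of positive integers and $\mathbb{R}^+$ the set of positive real numbers. A primitive point is a pair $(p,q)\in\mathbb{Z}^2$ with $\gcd(p,q)=1$. *)

(* Defs.v *)
From mathcomp Require Export all_boot all_order all_algebra.
From mathcomp Require Export all_classical all_reals all_analysis.
Export Order.TTheory GRing.Theory Num.Theory.
Export numFieldNormedType.Exports.

Set Implicit Arguments.
Unset Strict Implicit.
Unset Printing Implicit Defensive.

Local Open Scope classical_set_scope.
Local Open Scope ring_scope.

Definition primitive_point : set (int * int) := [set v | gcdz v.1 v.2 = 1].

(* [psi] stands for a function on the positive integers: its value at [0] is
   never used, since [`|q|%N] is positive when [1 <= q]. *)
Definition primitive_solutions (R : realType) (psi : nat -> R) (xi y : R) :
    set (int * int) :=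
  [set v | primitive_point v /\ 1 <= v.2 /\
           `|v.2%:~R * xi + v.1%:~R - y| <= psi `|v.2|%N].

(* Main.v *)
Require Import Defs.
From mathcomp Require Import measurable_realfun ring lra zify.

(** For a fixed denominator [q], the points [(xi, y)] with
    [|q xi + p - y| <= rho] for some integer [p] form a family of parallel
    strips of slope [q].  Two such families, of denominators [q < q'] and radii
    [rho] and [rho'], are almost independent: at the intersection of a strip of
    each the integer [p - p'] lies within [rho + rho'] of [(q' - q) xi], and at
    a given abscissa the overlap has height at most [2 min(rho, rho')].  With
    [d = q' - q], this bounds the measure of the overlap over a region of width
    [L] and height [T] by [8 (T + 3) (L + 3 / d) rho rho'] (lemma
    [near_line_pair_le]).

    Convergence.  In a bounded square the strips of denominator [q] have measure
    [O(psi q)] (lemma [near_box_le]).  A point with infinitely many solutions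
    has solutions of arbitrarily large denominator, because each [q] only admits
    finitely many [p], so the Borel-Cantelli lemma concludes.

    Divergence.  Let [approximable psi N] be the set of points having a
    primitive solution of denominator at least [N].  It has full measure as
    soon as it fills at least a proportion [c > 0] of every box, with [c]
    independent of the box: by [leb2_null_density], a planar set whose
    proportion in every box is at most [1 - c] is null.  The lower bound is
    [box_mass], obtained by the second moment method in a box of sides [s]
    and [t].

    - Divergence survives a dyadic regularisation of [psi].  On the block
      [2^m <= q < 2^(m+1)] use the constant radius
      [eps * min (psi (2^(m+1))) (2^-(m+1))]: by Cauchy condensation the sum of
      the radii still diverges, and now [rho q <= eps / q]
      (lemma [block_weights_diverge]).
    - First moment.  Among the pairs [(p, q)] with [q] in a dyadic block and [p]
      in a window of length about [s q], at least a fixed proportion is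
      primitive, since the pairs with a common divisor [k >= 2] have density at
      most the sum of [1 / k^2], which is below [3 / 4]
      (lemma [coprime_count_eventually]).  If [W] is the sum of the radii in
      use, the strips therefore have total measure at least [s t W / 16]
      (lemma [first_moment]).
    - Second moment.  When [q' >= K q], with [K] large in terms of [t], the
      overlap is at most [32 s t rho rho'], with a constant that does not see
      the box (lemma [level_pair_far]).  For [q < q' < K q] there is only a
      bound [C rho rho'] with [C] depending on the box (lemma
      [level_pair_near]), but [rho q <= eps / q] makes those pairs contribute
      at most [C K eps W] in total (lemma [pair_sum_le]), which is negligible
      once [eps] is small in terms of the box.

    By the Bonferroni inequality the union of the strips then has measure at
    least [s t W (1 / 16 - 32 W - 1 / 64)], and stopping the sum when [W] is
    about [1 / 2048] leaves a fixed proportion of the box. *)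

Set Implicit Arguments.
Unset Strict Implicit.
Unset Printing Implicit Defensive.

Local Open Scope classical_set_scope.
Local Open Scope ring_scope.

(** * A density criterion for null sets of the plane *)

Local Notation leb R := (@lebesgue_measure R).
Local Notation leb2 R := ((@lebesgue_measure R) \x (@lebesgue_measure R))%E.

Lemma leb2_le_sections (R : realType)
    (E : set (measurableTypeR R * measurableTypeR R)) (X : set (measurableTypeR R))
    (M : R) : 0 <= M -> measurable E -> measurable X ->
  (forall x, (leb R (xsection E x) <= (M * \1_X x)%:E)%E) ->
  (leb2 R E <= M%:E * leb R X)%E.
Proof.
move=> M0 mE mX h.
rewrite -[X in (_ * leb R X)%E](setIT X) -integral_indic// -ge0_integralZl_EFin//.
- apply: ge0_le_integral => //.
  + exact: (@measurable_fun_xsection _ _ _ _ _ (leb R)).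
  + apply: measurable_funeM; exact/measurable_EFinP/measurable_indic.
  + by move=> x _; rewrite -EFinM; exact: h.
- exact/measurable_EFinP/measurable_indic.
Qed.

Lemma leb2_ge_sections (R : realType)
    (E : set (measurableTypeR R * measurableTypeR R)) (X : set (measurableTypeR R))
    (M : R) : 0 <= M -> measurable E -> measurable X ->
  (forall x, X x -> M%:E <= leb R (xsection E x))%E ->
  (M%:E * leb R X <= leb2 R E)%E.
Proof.
move=> M0 mE mX h.
rewrite -[X in (_ * leb R X)%E](setIT X) -integral_indic// -ge0_integralZl_EFin//.
- apply: ge0_le_integral => //.
  + move=> x _ ; by rewrite -EFinM lee_fin mulr_ge0.
  + apply: measurable_funeM; exact/measurable_EFinP/measurable_indic.
  + exact: (@measurable_fun_xsection _ _ _ _ _ (leb R)).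
  + move=> x _; rewrite indicE; have [/set_mem/h|] := boolP (x \in X).
      by rewrite mule1.
    by rewrite mule0.
- exact/measurable_EFinP/measurable_indic.
Qed.

(** Lebesgue measure is the outer measure generated by half-open intervals: a
    comparison on intervals passes to countable covers, hence to all measurable
    sets. *)
Lemma measure_le_lebesgue (R : realType) (nu : {measure set (measurableTypeR R) -> \bar R}) (M : R) : 0 < M ->
  (forall a b : R, a < b -> (nu `]a, b]%classic <= (M * (b - a))%:E)%E) ->
  forall A, measurable A -> (nu A <= M%:E * leb R A)%E.
Proof.
move=> M0 h A mA.
rewrite -lee_pdivrMl//.
rewrite /lebesgue_measure/= /lebesgue_stieltjes_measure/= /measure_extension/=.
apply: le_ereal_inf_tmp => _ [F [mF AF] <-].
rewrite lee_pdivrMl//.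
have mF' n : measurable (F n : set (measurableTypeR R)).
  exact: sub_sigma_algebra.
apply: (le_trans (@measure_sigma_subadditive _ _ _ nu A F mF' mA AF)).
rewrite -nneseriesZl; last by move=> *; exact: wlength_ge0.
apply: lee_nneseries => [*|n _]; first exact: measure_ge0.
have [[u v] _ <-]/= := mF n.
have [uv|vu] := ltP u v.
  by apply: (le_trans (h _ _ uv)); rewrite wlength_itv_bnd ?(ltW uv)//.
by rewrite set_itv_ge ?measure0 ?wlength0 ?mule0// bnd_simp -leNgt.
Qed.

Lemma lebesgue_itvoc (R : realType) (a b : R) : a <= b ->
  leb R `]a, b]%classic = (b - a)%:E.
Proof.
rewrite lebesgue_measure_itv/= lte_fin le_eqVlt => /orP[/eqP->|->].
  by rewrite ltxx subrr.
by rewrite EFinB.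
Qed.

Lemma lebesgue_itvcc (R : realType) (a b : R) : a <= b ->
  leb R `[a, b]%classic = (b - a)%:E.
Proof.
rewrite lebesgue_measure_itv/= lte_fin le_eqVlt => /orP[/eqP->|->].
  by rewrite ltxx subrr.
by rewrite EFinB.
Qed.

Lemma measurable_leb_itv (R : realType) (i : interval R) :
  measurable ([set` i] : set (measurableTypeR R)).
Proof. exact: measurable_itv. Qed.

Lemma bigcup_itvoc (R : realType) : \bigcup_n `](- n%:R)%R, n%:R]%classic = [set: R].
Proof.
rewrite -subTset => /= x _ /=.
exists (Num.bound x); rewrite //= in_itv/= ltrNl.
by rewrite unstable.ltrNbound ltW// unstable.ltr_bound.
Qed.

Lemma lebesgue_null_local (R : realType) (A : set (measurableTypeR R)) :
  measurable A -> (forall n : nat, leb R (A `&` `](- n%:R)%R, n%:R]%classic) = 0%E) ->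
  leb R A = 0%E.
Proof.
move=> mA h.
suff: (leb R).-negligible A by move/negligibleP => ->.
rewrite -(setIT A) -bigcup_itvoc setI_bigcupr.
apply: negligible_bigcup => n.
by apply/negligibleP; [apply: measurableI => //; exact: measurable_leb_itv|exact: h].
Qed.

Lemma ereal_contract_eq0 (R : realType) (z : \bar R) (M : R) : M < 1 ->
  (0 <= z -> z < +oo -> z <= M%:E * z -> z = 0)%E.
Proof.
move=> M1; case: z => // r.
rewrite lee_fin => r0 _; rewrite -EFinM lee_fin => h; congr _%:E.
have : 0 <= (1 - M) * r by apply: mulr_ge0 => //; lra.
by nra.
Qed.

(** Applied to the measure [X |-> leb (A `&` X)], the comparison on intervals
    also holds when [X] is a bounded piece of [A], where it reads
    [leb X <= M * leb X] with [leb X] finite. *)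
Lemma lebesgue_null_density (R : realType) (A : set (measurableTypeR R)) (M : R) :
  0 < M < 1 -> measurable A ->
  (forall a b : R, a < b ->
    (leb R (A `&` `]a, b]%classic) <= (M * (b - a))%:E)%E) ->
  leb R A = 0%E.
Proof.
move=> /andP[M0 M1] mA h; apply: lebesgue_null_local => // n.
have mI : measurable (`](- n%:R)%R, n%:R]%classic : set (measurableTypeR R)) by exact: measurable_leb_itv.
apply: (ereal_contract_eq0 M1); first exact: measure_ge0.
  apply: (@le_lt_trans _ _ (leb R `](- n%:R)%R, n%:R]%classic)).
    by apply: le_measure; rewrite ?inE//; exact: measurableI.
  by rewrite lebesgue_itvoc ?ltry// -subr_ge0 opprK addr_ge0.
have /= := @measure_le_lebesgue R (mrestr (leb R) mA) M M0.
rewrite /mrestr /= => H.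
rewrite [X in (leb R X <= _)%E](_ : _ = (A `&` `](- n%:R)%R, n%:R]%classic) `&` A); last first.
  by rewrite setIAC setIid.
apply: H; last exact: measurableI.
by move=> a b ab; rewrite setIC; exact: h.
Qed.

Lemma xsectionIX (R : realType) (D : set (measurableTypeR R * measurableTypeR R)) (J : set (measurableTypeR R)) x :
  xsection (D `&` ([set: measurableTypeR R] `*` J)) x = xsection D x `&` J.
Proof. by apply/seteqP; split => y; rewrite /xsection /= !inE /=; tauto. Qed.

(** One of the two steps from boxes to sections.  For a fixed interval
    [`]b, c]], the measure [X |-> leb2 (D `&` (X `*` `]b, c]))] is at most
    [M * (c - b)] times Lebesgue measure; on the set of abscissas whose section
    has mass at least [M' * (c - b)] it is at least [M' * (c - b)] times
    Lebesgue measure.  As [M < M'], that set of abscissas is null. *)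
Lemma section_density (R : realType) (D : set (measurableTypeR R * measurableTypeR R))
    (M M' b c : R) :
  0 < M -> M < M' -> b < c -> measurable D ->
  (forall a a' : R, a < a' ->
    (leb2 R (D `&` (`]a, a']%classic `*` `]b, c]%classic)) <= (M * (a' - a) * (c - b))%:E)%E) ->
  (leb R).-negligible
    [set x | ((M' * (c - b))%:E <= leb R (xsection D x `&` `]b, c]%classic))%E].
Proof.
move=> M0 MM' bc mD h; set J : set (measurableTypeR R) := `]b, c]%classic.
have mJ : measurable J by exact: measurable_leb_itv.
have mDJ : measurable (D `&` ([set: measurableTypeR R] `*` J)).
  by apply: measurableI => //; exact: measurableX.
set X : set (measurableTypeR R) := [set x | _].
have mX : measurable X.
  rewrite (_ : X = (fun x => leb R (xsection (D `&` ([set: measurableTypeR R] `*` J)) x)) @^-1`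
       `[(M' * (c - b))%:E, +oo%E]%classic); last first.
    apply/seteqP; split => x; rewrite /X /= in_itv/= xsectionIX => H.
      by rewrite H leey.
    by case/andP: H.
  rewrite -[X in measurable X]setTI.
  apply: (@measurable_fun_xsection _ _ _ _ _ (leb R) _ mDJ) => //.
  exact: emeasurable_itv.
have mfst : measurable_fun [set: measurableTypeR R * measurableTypeR R] (@fst (measurableTypeR R) (measurableTypeR R)).
  exact: measurable_fst.
(* The measure [Y |-> leb2 (D `&` (Y `*` J))]. *)
pose nu0 : {measure set (measurableTypeR R) -> \bar R} :=
  pushforward (mrestr (leb2 R) mDJ) (@fst (measurableTypeR R) (measurableTypeR R)).
pose nu := nu0 mfst.
have nuE Y : nu Y = leb2 R (D `&` (Y `*` J)).
  rewrite /nu/= /pushforward /mrestr; congr (leb2 R _).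
  by apply/seteqP; split => -[x y] /=; tauto.
have cb : 0 < c - b by rewrite subr_gt0.
have nule := @measure_le_lebesgue R nu (M * (c - b)) (mulr_gt0 M0 cb).
apply/negligibleP => //; apply: lebesgue_null_local => // n.
set I : set (measurableTypeR R) := `](- n%:R)%R, n%:R]%classic.
have mI : measurable I by exact: measurable_leb_itv.
have mXI : measurable (X `&` I) by exact: measurableI.
have M'0 : 0 < M' by exact: lt_trans MM'.
(* The two bounds on the measure [nu] of [X `&` I] compare it with itself. *)
apply: (@ereal_contract_eq0 _ _ (M / M')).
- by rewrite ltr_pdivrMr// mul1r.
- exact: measure_ge0.
- apply: (@le_lt_trans _ _ (leb R I)).
    by apply: le_measure; rewrite ?inE//; exact: measurableI.
  by rewrite lebesgue_itvoc ?ltry// -subr_ge0 opprK addr_ge0.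
have /nule/(_ _ mXI) H : forall a a' : R, a < a' -> (nu `]a, a']%classic <= (M * (c - b) * (a' - a))%:E)%E.
  by move=> a a' aa'; rewrite nuE mulrAC; exact: h.
have H2 : ((M' * (c - b))%:E * leb R (X `&` I) <= nu (X `&` I))%E.
  rewrite nuE; apply: leb2_ge_sections => //.
  - by rewrite ltW// mulr_gt0.
  - by apply: measurableI => //; exact: measurableX.
  move=> x [Xx Ix]; apply: (le_trans Xx); apply: le_measure; rewrite ?inE.
  - by apply: measurableI => //; exact: measurable_xsection.
  - apply: measurable_xsection; apply: measurableI => //; exact: measurableX.
  move=> y [+ Jy]; rewrite /xsection /= !inE => Dxy; split => //; split => //=.
have := le_trans H2 H.
rewrite -lee_pdivlMl ?mulr_gt0// muleA -EFinM => /le_trans; apply.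
by rewrite (_ : (M' * (c - b))^-1 * _ = M / M')//; field; rewrite !gt_eqF.
Qed.

(** By [section_density], outside a null set of abscissas the bound holds
    simultaneously on all intervals with rational endpoints, hence on all
    intervals; such sections are null by [lebesgue_null_density]. *)
Lemma leb2_null_density (R : realType) (D : set (measurableTypeR R * measurableTypeR R)) (M : R) :
  0 < M < 1 -> measurable D ->
  (forall a a' b b' : R, a < a' -> b < b' ->
    (leb2 R (D `&` (`]a, a']%classic `*` `]b, b']%classic)) <= (M * (a' - a) * (b' - b))%:E)%E) ->
  leb2 R D = 0%E.
Proof.
move=> /andP[M0 M1] mD h.
(* Any constant strictly between [M] and [1]: it leaves the room that
   [section_density] needs while the sections stay of density below one. *)
pose M' := (M + 1) / 2.
have MM' : M < M' by rewrite /M'; lra.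
have M'1 : M' < 1 by rewrite /M'; lra.
pose rN (uv : rat * rat) : set (measurableTypeR R) := [set x |
  ((M' * (ratr uv.2 - ratr uv.1))%:E <=
    leb R (xsection D x `&` `]ratr uv.1, ratr uv.2]%classic))%E].
pose N (uv : rat * rat) := if (uv.1 < uv.2)%R then rN uv else set0.
have N0 : (leb R).-negligible (\bigcup_n (if unpickle n is Some uv then N uv else set0)).
  apply: negligible_bigcup => n; case: unpickle => [[u v]|]; last exact: negligible_set0.
  rewrite /N/=; case: ifPn => uv; last exact: negligible_set0.
  apply: (section_density M0 MM' _ mD); first by rewrite ltr_rat.
  by move=> a a' aa'; apply: h => //; rewrite ltr_rat.
rewrite /product_measure1.
have [Z [mZ Z0 NZ]] := N0.
rewrite (ae_eq_integral (cst 0%E)) ?integral0//.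
  exact: (@measurable_fun_xsection _ _ _ _ _ (leb R)).
exists Z; split => // x /= nx; apply: NZ; apply: contrapT => nN; apply: nx => _.
have mDx : measurable (xsection D x) by exact: measurable_xsection.
apply: (@lebesgue_null_density _ _ M') => //; first by rewrite (lt_trans M0).
move=> b c bc; rewrite leNgt; apply/negP => Hlt.
(* A strict inequality on [`]b, c]] survives on a slightly larger interval with
   rational endpoints. *)
have [e e0 He] : exists2 e : R, 0 < e & ((M' * (c - b + e + e))%:E < leb R (xsection D x `&` `]b, c]%classic))%E.
  have fin : (leb R (xsection D x `&` `]b, c]%classic) < +oo)%E.
    apply: (@le_lt_trans _ _ (leb R `]b, c]%classic)).
      by apply: le_measure; rewrite ?inE//; apply: measurableI => //.
    by rewrite lebesgue_itvoc ?ltry// ltW.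
  move: fin Hlt; case: (leb R (xsection D x `&` `]b, c]%classic)) => [r| |]//.
  rewrite lte_fin => _ Hlt.
  have M'0 : 0 < M' by exact: lt_trans MM'.
  set e := (r - M' * (c - b)) / 4.
  have e0 : 0 < e by rewrite divr_gt0// subr_gt0.
  have M'e : M' * e <= e by rewrite ger_pMl// ltW.
  exists e => //; rewrite lte_fin !mulrDr.
  have : 4 * e = r - M' * (c - b) by rewrite /e; field.
  rewrite mulrDr; lra.
have [u] := rat_in_itvoo (ltac:(rewrite ltrBlDr ltrDl; exact: e0) : b - e < b).
rewrite in_itv/= => /andP[bu ub].
have [v] := rat_in_itvoo (ltac:(rewrite ltrDl; exact: e0) : c < c + e).
rewrite in_itv/= => /andP[cv vc].
have uv : (u < v)%R by rewrite -(ltr_rat R); lra.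
apply: nN; exists (pickle (u, v)); first exact: I.
rewrite pickleK /N ifT; last exact: uv.
rewrite /rN [(u, v).1]/= [(u, v).2]/= /mkset.
apply: (@le_trans _ _ (M' * (c - b + e + e))%:E).
  rewrite lee_fin ler_wpM2l ?(ltW (lt_trans M0 _))//; lra.
apply: (le_trans (ltW He)); apply: le_measure; rewrite ?inE.
- by apply: measurableI => //; exact: measurable_leb_itv.
- by apply: measurableI => //; exact: measurable_leb_itv.
- move=> y [Dy]; rewrite /= !in_itv/= => /andP[by_ yc]; split => //=.
  by rewrite (lt_trans ub)// (le_trans yc)// ltW.
Qed.

(** * Strips of a given slope and their overlaps *)

(** The integers of an interval of length [L] are consecutive and at most
    [L + 1] in number. *)
Lemma int_window (R : realType) (x L : R) : 0 <= L ->
  exists (n0 : int) (k : nat), k%:R <= L + 1 /\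
    forall n : int, x <= n%:~R <= x + L -> exists i : nat, (i < k)%N /\ n = n0 + i%:Z.
Proof.
move=> L0; exists (Num.ceil x), (Num.truncn L).+1; split.
  by rewrite -addn1 natrD lerD2r truncn_le.
move=> n /andP[xn nx].
have cn : (Num.ceil x <= n)%R by rewrite ceil_le_int.
exists `|n - Num.ceil x|%N; split; last lia.
rewrite ltnS truncn_ge_nat// -[leLHS]/((Posz _)%:~R) gez0_abs ?subr_ge0// intrB.
have := ceil_ge x; lra.
Qed.

(** The set of [x] in an interval of length [L] with [d * x + th] within [r] of
    an integer is covered by at most [d * L + 2 * r + 1] intervals of length
    [2 * r / d].  An explicit measurable cover is more convenient than the
    measure of that set itself. *)
Lemma near_int_cover (R : realType) (d th r al L : R) : 0 < d -> 0 <= r <= 1 -> 0 <= L ->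
  exists X : set (measurableTypeR R), measurable X /\
    (leb R X <= ((d * L + 3) * (2 * r / d))%:E)%E /\
    forall (x : R) (n : int), al <= x <= al + L -> `|d * x + th - n%:~R| <= r -> X x.
Proof.
move=> d0 /andP[r0 r1] L0.
have dL0 : 0 <= d * L + 2 * r by rewrite addr_ge0// mulr_ge0// ltW.
have [n0 [k [kle H]]] := int_window (d * al + th - r) dL0.
pose F (i : nat) : set (measurableTypeR R) :=
  `[((n0 + i%:Z)%:~R - th - r) / d, ((n0 + i%:Z)%:~R - th + r) / d]%classic.
have mF i : measurable (F i) by exact: measurable_leb_itv.
exists (\big[setU/set0]_(i < k) F i).
have mU : measurable (\big[setU/set0]_(i < k) F i) by exact: bigsetU_measurable.
split => //; split.
  apply: (@le_trans _ _ (\sum_(i < k) leb R (F i))%E).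
    exact: (@content_subadditive _ _ _ (leb R) _ F).
  rewrite (eq_bigr (fun=> (2 * r / d)%:E)); last first.
    move=> i _; rewrite /F lebesgue_itvcc; last by rewrite ler_pM2r ?invr_gt0//; lra.
    by rewrite -mulrBl; congr (_ / d)%:E; lra.
  rewrite sumEFin sumr_const card_ord lee_fin -[leLHS]mulr_natl ler_wpM2r//.
    by rewrite divr_ge0// ?(ltW d0)// mulr_ge0.
  by apply: (le_trans kle); lra.
move=> x n /andP[alx xL] Hn.
have /H[i [ik nE]] : d * al + th - r <= n%:~R <= d * al + th - r + (d * L + 2 * r).
  move: Hn; rewrite ler_norml => /andP[H1 H2].
  have : d * al <= d * x by rewrite ler_pM2l.
  have : d * x <= d * (al + L) by rewrite ler_pM2l.
  rewrite mulrDr => *; apply/andP; split; lra.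
rewrite -bigcup_mkord; exists i => //.
rewrite /F/= in_itv/= -nE ler_pdivrMr// ler_pdivlMr//.
move: Hn; rewrite ler_norml => /andP[H1 H2]; apply/andP; split; lra.
Qed.

(** The union over all integers [p] of the closed strips of vertical half-width
    [rho] around the lines [y = q x + p]. *)
Definition near_line (R : realType) (q : nat) (rho : R) : set (R * R) :=
  [set z | exists p : int, `|q%:R * z.1 + p%:~R - z.2| <= rho].

Lemma near_line_section_le (R : realType) (S : set (measurableTypeR R * measurableTypeR R))
    (q : nat) (rho c T x : R) :
  0 <= rho <= 1 -> 0 <= T -> measurable S ->
  (forall y, S (x, y) -> near_line q rho (x, y) /\ c <= y <= c + T) ->
  (leb R (xsection S x) <= ((T + 3) * (2 * rho))%:E)%E.
Proof.
move=> rho01 T0 mS H.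
have [X [mX [leX HX]]] := @near_int_cover R 1 (- (q%:R * x)) rho c T ltr01 rho01 T0.
move: leX; rewrite mul1r divr1; apply: le_trans; apply: le_measure; rewrite ?inE//.
  exact: measurable_xsection.
move=> y; rewrite /xsection/= inE => /H[[p /= Hp] Hy].
apply: (HX _ p) => //; rewrite mul1r distrC; move: Hp; congr (`|_| <= _); ring.
Qed.

(** Subtracting the two conditions, [d * x] is within [rho + rho'] of an
    integer, which confines [x] to a set of measure at most
    [(d * L + 3) * 2 * (rho + rho') / d]; the vertical section at [x] is
    controlled by the smaller of the two radii, and
    [min(rho, rho') * (rho + rho') <= 2 * rho * rho'].  The vertical window may
    depend on [x] so that the lemma applies both to a box and to a thin strip. *)
Lemma near_line_pair_le (R : realType) (S : set (measurableTypeR R * measurableTypeR R))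
    (q d : nat) (rho rho' al L T : R) (c : R -> R) :
  (0 < d)%N -> 0 <= rho <= 1/2 -> 0 <= rho' <= 1/2 -> 0 <= L -> 0 <= T -> measurable S ->
  (forall x y, S (x, y) -> [/\ near_line q rho (x, y), near_line (q + d) rho' (x, y),
     al <= x <= al + L & c x <= y <= c x + T]) ->
  (leb2 R S <= (8 * (T + 3) * (L + 3 / d%:R) * (rho * rho'))%:E)%E.
Proof.
move=> d0 /andP[r0 r1] /andP[r'0 r'1] L0 T0 mS H.
have d0' : 0 < d%:R :> R by rewrite ltr0n.
have rr : 0 <= rho + rho' <= 1 by lra.
have [X [mX [leX HX]]] := @near_int_cover R d%:R 0 (rho + rho') al L d0' rr L0.
pose m := Num.min rho rho'.
have m0 : 0 <= m by rewrite /m le_min r0.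
have mrr : m * (rho + rho') <= 2 * (rho * rho').
  by rewrite /m; case: (leP rho rho') => ?; nra.
have M0 : 0 <= (T + 3) * (2 * m) by rewrite mulr_ge0//; lra.
apply: (@le_trans _ _ (((T + 3) * (2 * m))%:E * leb R X)%E).
  apply: leb2_le_sections => // x.
  have [xX|xX] := boolP (x \in X); last first.
    rewrite indicE (negbTE xX) mulr0 (_ : xsection S x = set0) ?measure0//.
    apply/seteqP; split => y //; rewrite /xsection/= inE => /H[[p /= Hp] [p' /= Hp'] Hx _].
    case/negP: xX; rewrite inE; apply: (HX x (p - p')) => //.
    rewrite addr0 intrB.
    rewrite (_ : _ - _ = ((q + d)%:R * x + p'%:~R - y) - (q%:R * x + p%:~R - y)); last by rewrite natrD; ring.
    by rewrite (le_trans (ler_normB _ _))// addrC lerD.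
  rewrite indicE xX mulr1 /m /Num.min; case: ifP => _.
    apply: (@near_line_section_le _ _ q _ (c x)) => //; first by lra.
    by move=> y /H[].
  apply: (@near_line_section_le _ _ (q + d) _ (c x)) => //; first by lra.
  by move=> y /H[].
apply: (@le_trans _ _ (((T + 3) * (2 * m))%:E * ((d%:R * L + 3) * (2 * (rho + rho') / d%:R))%:E)%E).
  by apply: lee_wpmul2l; rewrite ?lee_fin.
rewrite -EFinM lee_fin.
rewrite [leLHS](_ : _ = 4 * (T + 3) * (L + 3 / d%:R) * (m * (rho + rho'))); last first.
  by field; rewrite gt_eqF.
rewrite (_ : 8 * _ * _ * _ = 4 * (T + 3) * (L + 3 / d%:R) * (2 * (rho * rho'))); last by ring.
apply: ler_wpM2l => //.
by apply: mulr_ge0; [lra|rewrite addr_ge0// divr_ge0// ltW].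
Qed.

(** * Counting primitive points *)

Lemma divz_succ (k : nat) (w : int) : (0 < k)%N ->
  (((w + 1) %/ k)%Z = (w %/ k)%Z + (k%:Z %| w + 1)%Z%:Z)%R.
Proof.
move=> k0; have k0' : k%:Z != 0 by lia.
have [/dvdzP[v wE]|nd] := boolP (k%:Z %| w + 1)%Z.
  rewrite wE mulzK//; have -> : w = (v - 1) * k%:Z + (k.-1)%:Z by lia.
  by rewrite divzMDl// divz_small; lia.
rewrite addr0.
have r0 : ((w + 1) %% k)%Z != 0 by apply: contra nd => /eqP ?; apply/dvdz_mod0P.
have := divz_eq (w + 1) k; have := ltz_mod (w + 1) k0'; have := modz_ge0 (w + 1) k0'.
move: r0; move: ((w + 1) %/ k)%Z ((w + 1) %% k)%Z => v r r0 r1 r2 wE.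
have -> : w = v * k%:Z + (r - 1) by lia.
rewrite divzMDl// [((r - 1) %/ _)%Z]divz_small; last by lia.
by rewrite addr0.
Qed.

(** The count telescopes, because [w %/ k] increases by one exactly when [w]
    crosses a multiple of [k]. *)
Lemma count_multiples (k n : nat) (z : int) : (0 < k)%N ->
  (k * \sum_(i < n) (k%:Z %| (z + i%:Z)%R)%Z <= n + k)%N.
Proof.
move=> k0; have k0' : k%:Z != 0 by lia.
have E : (\sum_(i < n) (k%:Z %| (z + i%:Z)%R)%Z)%N%:Z = ((z + n%:Z - 1) %/ k)%Z - ((z - 1) %/ k)%Z.
  elim: n => [|n IH]; first by rewrite big_ord0 addr0 subrr.
  rewrite big_ord_recr/= PoszD IH.
  have -> : z + n.+1%:Z - 1 = (z + n%:Z - 1) + 1 by lia.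
  by rewrite divz_succ// (_ : z + n%:Z - 1 + 1 = z + n%:Z); lia.
have := divz_eq (z + n%:Z - 1) k; have := divz_eq (z - 1) k.
have := ltz_mod (z + n%:Z - 1) k0'; have := modz_ge0 (z + n%:Z - 1) k0'.
have := ltz_mod (z - 1) k0'; have := modz_ge0 (z - 1) k0'.
move: E; set S := (\sum_(i < n) _)%N; nia.
Qed.

(** For [k >= 3], [1 / k^2 <= 1 / (k - 1) - 1 / k], so the sum is at most
    [1 / 4 + 1 / 2]; the induction carries the remainder of the telescoping
    sum. *)
Lemma sum_inv_sqr_le (R : realType) (n : nat) :
  \sum_(2 <= k < n) (k%:R ^+ 2)^-1 <= 3 / 4 :> R.
Proof.
case: n => [|[|[|j]]]; do 3?[by rewrite big_geq//; lra].
suff: \sum_(2 <= k < j.+3) (k%:R ^+ 2)^-1 <= 3 / 4 - j.+2%:R^-1 :> R.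
  have : 0 <= j.+2%:R^-1 :> R by rewrite invr_ge0.
  by move=> h /le_trans; apply; rewrite gerBl.
elim: j => [|j IH]; first by rewrite big_nat1; lra.
rewrite big_nat_recr//=.
have j0 : 0 < j%:R + 2 :> R by rewrite ltr_wpDl.
have E2 : j.+2%:R = j%:R + 2 :> R by rewrite -addn2 natrD.
have E3 : j.+3%:R = j%:R + 3 :> R by rewrite -addn3 natrD.
apply: (le_trans (lerD IH (lexx _))); rewrite E2 E3.
rewrite -subr_ge0 (_ : _ - _ = ((j%:R + 2) * (j%:R + 3) ^+ 2)^-1).
  by rewrite invr_ge0 mulr_ge0 ?sqr_ge0 ?ltW.
by field; rewrite !gt_eqF//; lra.
Qed.

(** Each dyadic block of the harmonic sum contributes at most one. *)
Lemma sum_inv_le (R : realType) (m : nat) :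
  \sum_(2 <= k < 2 ^ m.+1) k%:R^-1 <= m%:R :> R.
Proof.
elim: m => [|m IH]; first by rewrite big_geq.
have H1 : (2 <= 2 ^ m.+1)%N by rewrite expnS leq_pmulr// expn_gt0.
have H2 : (2 ^ m.+1 <= 2 ^ m.+2)%N by rewrite leq_exp2l.
rewrite (big_cat_nat H1 H2)//= -[m.+1%:R]natr1 lerD//.
rewrite big_nat.
apply: (@le_trans _ _ (\sum_(2 ^ m.+1 <= k < 2 ^ m.+2) (2 ^ m.+1)%:R^-1)).
  rewrite [leRHS]big_nat; apply: ler_sum => k /andP[k1 _].
  by rewrite lef_pV2 ?ler_nat ?posrE ?ltr0n ?expn_gt0// (leq_trans _ k1)// expn_gt0.
rewrite sumr_const_nat -[leLHS]mulr_natl (_ : (2 ^ m.+2 - 2 ^ m.+1 = 2 ^ m.+1)%N); last first.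
  by rewrite [(2 ^ m.+2)%N]expnS; lia.
by rewrite mulfV// pnatr_eq0 expn_eq0.
Qed.

Lemma coprime_or_common_divisor (z : int) (q n : nat) : (0 < q < n)%N ->
  (1 <= coprimez z q + \sum_(2 <= k < n) (k %| q) * (k%:Z %| z)%Z)%N.
Proof.
move=> /andP[q0 qn].
have [//|nc] := boolP (coprimez z q).
rewrite add0n; set g := gcdn `|z| q.
have gq : (g %| q)%N by exact: dvdn_gcdr.
have gz : (g%:Z %| z)%Z by rewrite dvdzE; exact: dvdn_gcdl.
have g1 : (2 <= g)%N.
  move: nc; rewrite coprimezE /coprime -/g.
  have : (0 < g)%N by rewrite (dvdn_gt0 q0).
  by case: (g) => [|[|]].
have gn : (g < n)%N by rewrite (leq_ltn_trans (dvdn_leq q0 gq)).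
rewrite (bigD1_seq g) ?iota_uniq ?mem_index_iota ?g1 ?gn//= gq gz.
by [].
Qed.

(** The sieve by all [k >= 2], rather than by primes: the pairs divisible by
    [k] number at most [(Q / k + 1) * (kap / k + 1)].  The windows [z j] are
    arbitrary because the bound for each [k] only involves their length. *)
Lemma coprime_count (R : realType) (m kap : nat) (z : nat -> int) (Q := (2 ^ m)%N) :
  (Q * kap)%:R / 4 - (Q + kap)%:R * m%:R - 2 * Q%:R <=
  (\sum_(j < Q) \sum_(i < kap) coprimez (z j + i%:Z)%R (Q + j)%N)%N%:R :> R.
Proof.
have Q0 : (0 < Q)%N by rewrite expn_gt0.
set N := (X in _ <= X%:R).
pose c (k : nat) := (\sum_(j < Q) \sum_(i < kap) (k %| Q + j) * (k%:Z %| (z j + i%:Z)%R)%Z)%N.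
have H1 : (Q * kap <= N + \sum_(2 <= k < 2 ^ m.+1) c k)%N.
  rewrite /c [X in (_ + X)%N]exchange_big /= -big_split/=.
  rewrite -[Q in (Q * _)%N]card_ord -sum_nat_const; apply: leq_sum => j _.
  rewrite exchange_big /= -big_split/=.
  rewrite -[X in (X <= _)%N]card_ord -sum1_card; apply: leq_sum => i _.
  apply: coprime_or_common_divisor; rewrite addn_gt0 Q0/= expnS mul2n -addnn.
  by rewrite ltn_add2l.
have H2 (k : nat) : (2 <= k)%N ->
    (c k)%:R <= (Q * kap)%:R * (k%:R ^+ 2)^-1 + (Q + kap)%:R * k%:R^-1 + 1 :> R.
  move=> k2; have k0 : (0 < k)%N by exact: leq_trans k2.
  have kR : 0 < k%:R :> R by rewrite ltr0n.
  have : (k * (k * c k) <= (Q + k) * (kap + k))%N.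
    apply: (@leq_trans (k * \sum_(j < Q) (k %| Q + j) * (kap + k))%N).
      rewrite leq_mul2l; apply/orP; right; rewrite /c big_distrr/=; apply: leq_sum => j _.
      rewrite -big_distrr/= mulnCA leq_mul2l; apply/orP; right; exact: count_multiples.
    rewrite -big_distrl/= mulnA leq_mul2r; apply/orP; right.
    rewrite (eq_bigr (fun j : 'I_Q => (k%:Z %| (Q%:Z + j%:Z)%R)%Z : nat)); last first.
      by move=> j _; rewrite -PoszD dvdzE.
    exact: count_multiples.
  rewrite -(ler_nat R) !natrM !natrD => H.
  rewrite -subr_ge0 (_ : _ - _ = ((Q%:R + k%:R) * (kap%:R + k%:R) - k%:R * (k%:R * (c k)%:R)) / k%:R ^+ 2).
    by rewrite divr_ge0 ?sqr_ge0// subr_ge0.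
  by field; rewrite gt_eqF.
have H3 : (\sum_(2 <= k < 2 ^ m.+1) c k)%:R <=
    (Q * kap)%:R * (3 / 4) + (Q + kap)%:R * m%:R + 2 * Q%:R :> R.
  rewrite natr_sum.
  apply: (@le_trans _ _ (\sum_(2 <= k < 2 ^ m.+1)
     ((Q * kap)%:R * (k%:R ^+ 2)^-1 + (Q + kap)%:R * k%:R^-1 + 1))).
    by rewrite !big_nat; apply: ler_sum => k /andP[k2 _]; exact: H2.
  rewrite !big_split/= -!mulr_sumr; apply: lerD.
    by apply: lerD; rewrite ler_wpM2l// ?sum_inv_sqr_le ?sum_inv_le.
  rewrite sumr_const_nat -natrM ler_nat /Q expnS; lia.
move: H1; rewrite -(ler_nat R) natrD.
move: H3; set S := (\sum_(2 <= k < _) c k)%:R; lra.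
Qed.

(** Since [m^2 <= 2 * 2^m], it is enough that [m] exceed
    [2 * (A + B) / c]. *)
Lemma pow2_beats_linear (R : realType) (A B c : R) : 0 <= A -> 0 <= B -> 0 < c ->
  exists m0 : nat, forall m, (m0 <= m)%N -> A + B * m%:R <= c * (2 ^ m)%:R.
Proof.
move=> A0 B0 c0.
have sq m : (m ^ 2 <= 2 * 2 ^ m)%N.
  do 3?[case: m => [//|m]].
  by elim: m => [//|m]; rewrite [(2 ^ m.+4)%N]expnS; nia.
exists (Num.truncn (2 * (A + B) / c)).+1 => m m0.
have mA : 2 * (A + B) / c <= m%:R.
  by apply: ltW; apply: (lt_le_trans (truncnS_gt _)); rewrite ler_nat.
have m1 : 1 <= m%:R :> R by rewrite ler1n (leq_trans _ m0).
apply: (@le_trans _ _ ((A + B) * m%:R)).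
  rewrite mulrDl lerD2r ler_peMr//.
have : m%:R ^+ 2 <= 2 * (2 ^ m)%:R :> R by rewrite -natrX -natrM ler_nat.
move: mA; rewrite ler_pdivrMr// => mA Hm.
have : (2 * (A + B)) * m%:R <= m%:R * c * m%:R by rewrite ler_wpM2r.
have : c * m%:R ^+ 2 <= c * (2 * (2 ^ m)%:R) by rewrite ler_wpM2l// ltW.
rewrite expr2; lra.
Qed.

Lemma coprime_count_eventually (R : realType) (s u : R) : 0 < s -> 0 <= u ->
  exists m0 : nat, forall (m : nat) (z : nat -> int) (kap := Num.truncn (s * (2 ^ m)%:R - u)),
    (m0 <= m)%N ->
    kap%:R <= s * (2 ^ m)%:R - u /\
    s * (2 ^ m)%:R ^+ 2 / 8 <=
      (\sum_(j < 2 ^ m) \sum_(i < kap) coprimez (z j + i%:Z)%R (2 ^ m + j)%N)%N%:R :> R.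
Proof.
move=> s0 u0.
have [m1 Hm1] := @pow2_beats_linear R u 0 s u0 (lexx _) s0.
have [m2 Hm2] := @pow2_beats_linear R ((u + 1) / 4 + 2) (1 + s) (s / 8) (ltac:(lra)) (ltac:(lra)) (ltac:(lra)).
exists (maxn m1 m2) => m z kap; rewrite geq_max => /andP[/Hm1 + /Hm2]; rewrite mul0r addr0.
set Q := (2 ^ m)%N => H1 H2.
have w0 : 0 <= s * Q%:R - u by rewrite subr_ge0.
have kle : kap%:R <= s * Q%:R - u by rewrite truncn_le.
split => //.
apply: le_trans (@coprime_count R m kap z); rewrite -/Q.
have kge : s * Q%:R - u <= kap%:R + 1 by rewrite natr1 ltW// truncnS_gt.
have Q0 : 0 <= Q%:R :> R by [].
have m0 : 0 <= m%:R :> R by [].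
have : Q%:R * (((u + 1) / 4 + 2) + (1 + s) * m%:R) <= Q%:R * (s / 8 * Q%:R) by rewrite ler_wpM2l.
have : Q%:R * (s * Q%:R - u) <= Q%:R * (kap%:R + 1) by rewrite ler_wpM2l.
have : m%:R * kap%:R <= m%:R * (s * Q%:R) by rewrite ler_wpM2l//; lra.
rewrite natrM natrD expr2; lra.
Qed.

(** * Strips crossing a box, and their total measure *)

(** The part of the strip around [y = q x + p] where the line itself runs in
    the middle half of the heights of [`]b, b + t]]; for [rho <= t / 8] it
    stays in that horizontal band, and its measure is [rho * t / q]. *)
Definition strip (R : realType) (b t rho : R) (q : nat) (p : int) :
    set (measurableTypeR R * measurableTypeR R) :=
  [set z | b + t / 4 <= q%:R * z.1 + p%:~R <= b + 3 * t / 4 /\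
           `|q%:R * z.1 + p%:~R - z.2| <= rho].

Lemma measurable_affine_itv (R : realType) (u v w : R) (i : interval R) :
  measurable ([set z | u * z.1 + v * z.2 + w \in i] :
    set (measurableTypeR R * measurableTypeR R)).
Proof.
rewrite -[X in measurable X]setTI.
have mf : measurable_fun [set: measurableTypeR R * measurableTypeR R]
   (fun z => u * z.1 + v * z.2 + w : measurableTypeR R).
  apply: measurable_funD => //; apply: measurable_funD; apply: measurable_funM => //.
exact: (mf measurableT _ (measurable_leb_itv i)).
Qed.

Lemma measurable_strip (R : realType) (b t rho : R) q p : measurable (strip b t rho q p).
Proof.
rewrite (_ : strip b t rho q p =
   [set z | q%:R * z.1 + 0 * z.2 + p%:~R \in `[b + t / 4, b + 3 * t / 4]] `&`
   [set z | q%:R * z.1 + (- 1) * z.2 + p%:~R \in `[- rho, rho]]).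
  by apply: measurableI; exact: measurable_affine_itv.
apply/seteqP; split => z; rewrite /strip /= !in_itv/= mul0r addr0 mulN1r ler_norml.
  by rewrite addrAC.
by rewrite addrAC.
Qed.

Lemma strip_ge (R : realType) (b t rho : R) q p : (0 < q)%N -> 0 < t -> 0 <= rho ->
  ((rho * t / q%:R)%:E <= leb2 R (strip b t rho q p))%E.
Proof.
move=> q0 t0 rho0; have q0' : 0 < q%:R :> R by rewrite ltr0n.
set X : set (measurableTypeR R) := `[(b + t / 4 - p%:~R) / q%:R, (b + 3 * t / 4 - p%:~R) / q%:R]%classic.
have -> : (rho * t / q%:R)%:E = ((2 * rho)%:E * leb R X)%E.
  rewrite lebesgue_itvcc; last by rewrite ler_pM2r ?invr_gt0//; lra.
  by rewrite -EFinM; congr _%:E; field; rewrite gt_eqF.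
apply: leb2_ge_sections.
- by rewrite mulr_ge0.
- exact: measurable_strip.
- exact: measurable_leb_itv.
move=> x; rewrite /X/= in_itv/= ler_pdivrMr// ler_pdivlMr// => /andP[x1 x2].
rewrite (_ : (2 * rho)%:E = leb R `[q%:R * x + p%:~R - rho, q%:R * x + p%:~R + rho]%classic); last first.
  by rewrite lebesgue_itvcc; [congr _%:E|]; lra.
apply: le_measure; rewrite ?inE.
- exact: measurable_leb_itv.
- by apply: measurable_xsection; exact: measurable_strip.
move=> y; rewrite /xsection/= in_itv/= inE /strip/= => /andP[y1 y2]; split.
  apply/andP; split; lra.
rewrite ler_norml; apply/andP; split; lra.
Qed.

Lemma strip_disjoint (R : realType) (b t rho : R) q p p' : rho < 1/2 ->
  strip b t rho q p `&` strip b t rho q p' !=set0 -> p = p'.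
Proof.
move=> rho2 [z [[_ +] [_ +]]]; rewrite !ler_norml => /andP[h1 h2] /andP[h3 h4].
have : `|p%:~R - p'%:~R| < 1 :> R by rewrite ltr_norml; apply/andP; split; lra.
rewrite -intrB -intr_norm -[1]/(1%:~R) ltr_int; lia.
Qed.

(** The admissible [p], for which the strip crosses the box from its bottom to
    its top, form a window: this is its first element. *)
Definition window_start (R : realType) (a s b t : R) (q : nat) : int :=
  Num.ceil (b + 3 * t / 4 - q%:R * (a + s)).

(** The length is computed from the power of two below [q], so that it is
    constant on dyadic blocks, as [coprime_count] requires. *)
Definition window_size (R : realType) (s t : R) (q : nat) : nat :=
  Num.truncn (s * (2 ^ trunc_log 2 q)%:R - t / 2).

Definition cell (R : realType) (a s b t rho : R) (q i : nat) :=
  let p := window_start a s b t q + i%:Z in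
  if coprimez p q then strip b t rho q p else set0.

(** The strips of denominator [q] that are kept: those crossing the box, with
    [p] in the window and coprime to [q]. *)
Definition level (R : realType) (a s b t rho : R) (q : nat) :=
  \big[setU/set0]_(i < window_size s t q) cell a s b t rho q i.

Lemma measurable_cell (R : realType) (a s b t rho : R) q i : measurable (cell a s b t rho q i).
Proof. by rewrite /cell; case: ifP => // _; exact: measurable_strip. Qed.

Lemma measurable_level (R : realType) (a s b t rho : R) q : measurable (level a s b t rho q).
Proof. by apply: bigsetU_measurable => i _; exact: measurable_cell. Qed.

Lemma level_inv (R : realType) (a s b t rho : R) q z : level a s b t rho q z ->
  exists i, [/\ (i < window_size s t q)%N, coprimez (window_start a s b t q + i%:Z) q &
    strip b t rho q (window_start a s b t q + i%:Z) z].
Proof.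
rewrite /level -bigcup_mkord => -[i /= ik]; rewrite /cell; case: ifPn => // cp h.
by exists i.
Qed.

Lemma trunc_log2_block (m j : nat) : (j < 2 ^ m)%N -> trunc_log 2 (2 ^ m + j) = m.
Proof. by move=> jm; apply: trunc_log_eq => //; rewrite leq_addr expnS mul2n -addnn ltn_add2l. Qed.

Lemma strip_window_box (R : realType) (a s b t rho : R) q i z : (0 < q)%N -> 0 < s -> 0 < t -> rho <= t / 8 ->
  t / 2 <= s * (2 ^ trunc_log 2 q)%:R ->
  (i < window_size s t q)%N ->
  strip b t rho q (window_start a s b t q + i%:Z) z ->
  a < z.1 <= a + s /\ b < z.2 <= b + t.
Proof.
move=> q0 s0 t0 rt big iw [/andP[h1 h2]]; rewrite ler_norml => /andP[h3 h4].
have q0' : 0 < q%:R :> R by rewrite ltr0n.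
split; last by apply/andP; split; lra.
have Qq : (2 ^ trunc_log 2 q)%:R <= q%:R :> R by rewrite ler_nat trunc_logP.
have sQq := ler_wpM2l (ltW s0) Qq.
set p := (window_start _ _ _ _ _ + _) in h1 h2 *.
have iw' : i%:R + 1 <= s * (2 ^ trunc_log 2 q)%:R - t / 2.
  apply: (@le_trans _ _ (window_size s t q)%:R); first by rewrite natr1 ler_nat.
  by rewrite /window_size truncn_le subr_ge0.
have pE : p%:~R = (window_start a s b t q)%:~R + i%:R :> R by rewrite /p intrD.
have := ceil_ge (b + 3 * t / 4 - q%:R * (a + s)).
have := ceilB1_lt (b + 3 * t / 4 - q%:R * (a + s)).
rewrite -/(window_start a s b t q) intrB => c1 c2.
have i0 : 0 <= i%:R :> R by [].
rewrite -(ltr_pM2l q0') -(ler_pM2l q0').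
move: c1 c2 h1 h2; rewrite pE !mulrDr => *; apply/andP; split; lra.
Qed.

(** For [rho < 1 / 2] the strips of a given denominator are pairwise disjoint,
    so their measures add up. *)
Lemma level_ge (R : realType) (a s b t rho : R) q : (0 < q)%N -> 0 < t -> 0 <= rho < 1/2 ->
  ((rho * t / q%:R * (\sum_(i < window_size s t q) coprimez (window_start a s b t q + i%:Z)%R q)%N%:R)%:E
   <= leb2 R (level a s b t rho q))%E.
Proof.
move=> q0 t0 /andP[rho0 rho2].
rewrite /level measure_bigsetU; last 2 first.
- by move=> i; exact: measurable_cell.
- apply/trivIsetP => i j _ _ /eqP ij; apply/seteqP; split => // z; rewrite /cell.
  case: ifP => _; case: ifP => _ [h1 h2] //; apply: ij.
  have : window_start a s b t q + i%:Z = window_start a s b t q + j%:Z.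
    by apply: (@strip_disjoint _ b t rho q) => //; exists z.
  by move/addrI => [].
rewrite natr_sum mulr_sumr -sumEFin; apply: lee_sum => i _; rewrite /cell.
case: ifP => _; last by rewrite mulr0 measure_ge0.
by rewrite mulr1 strip_ge.
Qed.

Lemma sum_dyadic (V : nmodType) (F : nat -> V) (m0 m1 : nat) : (m0 <= m1)%N ->
  \sum_(2 ^ m0 <= q < 2 ^ m1) F q = \sum_(m0 <= m < m1) \sum_(j < 2 ^ m) F (2 ^ m + j)%N.
Proof.
elim: m1 => [|m1 IH]; first by rewrite leqn0 => /eqP->; rewrite !big_geq.
rewrite leq_eqVlt => /orP[/eqP->|]; first by rewrite !big_geq.
rewrite ltnS => m01; rewrite big_nat_recr//= -IH//.
rewrite (@big_cat_nat _ _ _ (2 ^ m1))/= ?leq_exp2l//; congr (_ + _).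
rewrite -{1}[(2 ^ m1)%N]add0n big_addn expnS mul2n -addnn addnK big_mkord.
by apply: eq_bigr => j _; rewrite addnC.
Qed.

(** On a dyadic block the radius is constant and [1 / q >= 1 / (2 Q)], so the
    count of primitive points in the block gives the total measure directly. *)
Lemma first_moment (R : realType) (a s b t eps : R) (r : nat -> R) (m0 m1 : nat) :
  0 < s -> 0 < t -> 0 <= eps -> (forall m, 0 <= r m) -> (m0 <= m1)%N ->
  (forall m, (m0 <= m)%N -> eps * r m < 1/2) ->
  (forall (m : nat) (z : nat -> int) (kap := Num.truncn (s * (2 ^ m)%:R - t / 2)),
    (m0 <= m)%N ->
    s * (2 ^ m)%:R ^+ 2 / 8 <=
      (\sum_(j < 2 ^ m) \sum_(i < kap) coprimez (z j + i%:Z)%R (2 ^ m + j)%N)%N%:R) ->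
  ((s * t / 16 * (eps * \sum_(m0 <= m < m1) (2 ^ m)%:R * r m))%:E <=
   \sum_(2 ^ m0 <= q < 2 ^ m1) leb2 R (level a s b t (eps * r (trunc_log 2 q)) q))%E.
Proof.
move=> s0 t0 e0 r0 m01 rsmall H.
rewrite sum_dyadic// !mulr_sumr -sumEFin !big_nat; apply: lee_sum => m /andP[mm0 _].
set Q := (2 ^ m)%N.
have Q0 : 0 < Q%:R :> R by rewrite ltr0n expn_gt0.
have er0 : 0 <= eps * r m by rewrite mulr_ge0.
pose N (j : nat) := (\sum_(i < Num.truncn (s * Q%:R - t / 2)) coprimez (window_start a s b t (Q + j) + i%:Z)%R (Q + j)%N)%N.
apply: (@le_trans _ _ (\sum_(j < Q) (eps * r m * t / (2 * Q%:R) * (N j)%:R)%:E)%E).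
  rewrite sumEFin lee_fin -mulr_sumr -natr_sum.
  have HN := H m (fun j => window_start a s b t (Q + j)) mm0.
  apply: (@le_trans _ _ (eps * r m * t / (2 * Q%:R) * (s * Q%:R ^+ 2 / 8))).
    by rewrite le_eqVlt; apply/orP; left; apply/eqP; field; rewrite gt_eqF.
  by rewrite ler_wpM2l// divr_ge0 ?mulr_ge0// ltW.
apply: lee_sum => j _.
have qj : trunc_log 2 (Q + j) = m by exact: trunc_log2_block.
have Qj0 : (0 < Q + j)%N by rewrite addn_gt0 expn_gt0.
have rj : 0 <= eps * r (trunc_log 2 (Q + j)) < 1/2 by rewrite qj er0 rsmall.
apply: le_trans (level_ge a s b Qj0 t0 rj); rewrite qj /window_size qj -/(N j) lee_fin.
rewrite ler_wpM2r//; apply: ler_wpM2l; first by rewrite mulr_ge0// ltW.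
rewrite lef_pV2 ?posrE ?ltr0n// ?mulr_gt0//.
by rewrite -natrM ler_nat mul2n -addnn leq_add2l ltnW.
Qed.

(** * Correlations between denominators *)

Lemma strip_near_line (R : realType) (b t rho : R) q p z :
  strip b t rho q p z -> near_line q rho z.
Proof. by move=> [_ h]; exists p. Qed.

Lemma level_near_line (R : realType) (a s b t rho : R) q z :
  level a s b t rho q z -> near_line q rho z.
Proof. by move=> /level_inv[i [_ _ /strip_near_line]]. Qed.

Lemma level_box (R : realType) (a s b t rho : R) q z : (0 < q)%N -> 0 < s -> 0 < t -> rho <= t / 8 ->
  t / 2 <= s * (2 ^ trunc_log 2 q)%:R -> level a s b t rho q z ->
  a < z.1 <= a + s /\ b < z.2 <= b + t.
Proof. by move=> q0 s0 t0 rt big /level_inv[i [iw _]]; exact: strip_window_box. Qed.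

(** The constant depends on the box: this is used only for denominators
    within a bounded ratio of each other. *)
Lemma level_pair_near (R : realType) (a s b t rho rho' : R) (q q' : nat) :
  (0 < q < q')%N -> 0 < s -> 0 < t -> 0 <= rho <= 1/2 -> 0 <= rho' <= 1/2 -> rho <= t / 8 ->
  t / 2 <= s * (2 ^ trunc_log 2 q)%:R ->
  (leb2 R (level a s b t rho q `&` level a s b t rho' q') <=
    (8 * (t + 3) * (s + 3) * (rho * rho'))%:E)%E.
Proof.
move=> /andP[q0 qq'] s0 t0 h h' rt big.
have d0 : (0 < q' - q)%N by rewrite subn_gt0.
have mS : measurable (level a s b t rho q `&` level a s b t rho' q').
  by apply: measurableI; exact: measurable_level.
apply: (le_trans (@near_line_pair_le _ _ q (q' - q)%N rho rho' a s t (fun=> b) d0 h h' (ltW s0) (ltW t0) mS _)).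
  move=> x y [h1 h2]; have /= [/andP[x1 x2] /andP[y1 y2]] := level_box q0 s0 t0 rt big h1.
  split; [exact: level_near_line h1|rewrite subnKC 1?ltnW//; exact: level_near_line h2| |].
    by rewrite (ltW x1).
  by rewrite (ltW y1).
have d1 : 1 <= (q' - q)%:R :> R by rewrite ler1n.
rewrite lee_fin ler_wpM2r//; first by case/andP: h => *; case/andP: h' => *; rewrite mulr_ge0.
rewrite ler_wpM2l//; first by rewrite mulr_ge0//; lra.
rewrite lerD2l ler_pdivrMr ?(lt_le_trans _ d1)//; lra.
Qed.

(** Localise to one strip of denominator [q], of width [t / (2 * q)]: as
    [q' - q] is large, the finer family is already equidistributed there, and
    the error term [3 / (q' - q)] of [near_line_pair_le] is absorbed by the
    width.  There are at most [s * q] such strips. *)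
Lemma level_pair_far (R : realType) (a s b t rho rho' : R) (q q' : nat) :
  (0 < q < q')%N -> 0 < s -> 0 < t -> 0 <= rho <= 1/2 -> 0 <= rho' <= 1/2 ->
  t / 2 <= s * (2 ^ trunc_log 2 q)%:R ->
  6 * q%:R <= t * (q' - q)%:R ->
  (leb2 R (level a s b t rho q `&` level a s b t rho' q') <=
    (32 * (s * t) * (rho * rho'))%:E)%E.
Proof.
move=> /andP[q0 qq'] s0 t0 h h' big far.
have d0 : (0 < q' - q)%N by rewrite subn_gt0.
have q0' : 0 < q%:R :> R by rewrite ltr0n.
have d0' : 0 < (q' - q)%:R :> R by rewrite ltr0n.
have rr0 : 0 <= rho * rho' by case/andP: h => *; case/andP: h' => *; rewrite mulr_ge0.
pose F (i : nat) := cell a s b t rho q i `&` level a s b t rho' q'.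
have mF i : measurable (F i).
  by apply: measurableI; [exact: measurable_cell|exact: measurable_level].
apply: (@le_trans _ _ (\sum_(i < window_size s t q) leb2 R (F i))%E).
  apply: (@content_subadditive _ _ _ (leb2 R) _ F) => //.
    by apply: measurableI; exact: measurable_level.
  by rewrite /F /level big_distrl.
apply: (@le_trans _ _ (\sum_(i < window_size s t q) (32 * (t / q%:R) * (rho * rho'))%:E)%E).
  apply: lee_sum => i _; rewrite /F /cell; case: ifP => _; last first.
    by rewrite set0I measure0 lee_fin mulr_ge0// mulr_ge0// divr_ge0// ltW.
  set p := (window_start _ _ _ _ _ + _).
  have L0 : 0 <= t / (2 * q%:R) by rewrite divr_ge0 ?mulr_ge0// ltW.
  have T0 : 0 <= 2 * rho by lra.
  have mS : measurable (strip b t rho q p `&` level a s b t rho' q').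
    by apply: measurableI; [exact: measurable_strip|exact: measurable_level].
  apply: (le_trans (@near_line_pair_le _ _ q (q' - q)%N rho rho' ((b + t / 4 - p%:~R) / q%:R)
    (t / (2 * q%:R)) (2 * rho) (fun x => q%:R * x + p%:~R - rho) d0 h h' L0 T0 mS _)).
    move=> x y [h1 h2]; split.
    - exact: strip_near_line h1.
    - by rewrite subnKC 1?ltnW//; exact: level_near_line h2.
    - case: h1 => /= /andP[h1 h3] _; rewrite ler_pdivrMr//.
      rewrite (_ : _ / _ + _ = (b + 3 * t / 4 - p%:~R) / q%:R); last by field; rewrite gt_eqF.
      rewrite ler_pdivlMr//; apply/andP; split; lra.
    - case: h1 => _ /=; rewrite ler_norml => /andP[h1 h3]; apply/andP; split; lra.
  rewrite lee_fin ler_wpM2r//.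
  have H3 : 3 / (q' - q)%:R <= t / (2 * q%:R).
    by rewrite ler_pdivrMr// mulrAC ler_pdivlMr ?mulr_gt0//; lra.
  have H4 : t / (2 * q%:R) + 3 / (q' - q)%:R <= t / q%:R.
    rewrite (_ : t / q%:R = t / (2 * q%:R) + t / (2 * q%:R)); last by field; rewrite gt_eqF.
    by rewrite lerD2l.
  have tq0 : 0 <= t / q%:R by rewrite divr_ge0// ltW.
  apply: (@le_trans _ _ (8 * (2 * rho + 3) * (t / q%:R))); first by rewrite ler_wpM2l//; lra.
  by rewrite ler_wpM2r//; lra.
rewrite sumEFin lee_fin sumr_const card_ord -[leLHS]mulr_natl.
rewrite [leLHS]mulrA ler_wpM2r//.
have wle : (window_size s t q)%:R <= s * q%:R.
  apply: (@le_trans _ _ (s * (2 ^ trunc_log 2 q)%:R - t / 2)).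
    by rewrite /window_size truncn_le subr_ge0.
  have : s * (2 ^ trunc_log 2 q)%:R <= s * q%:R by rewrite ler_wpM2l ?(ltW s0)// ler_nat trunc_logP.
  lra.
rewrite (_ : 32 * (s * t) = s * q%:R * (32 * (t / q%:R))); last by field; rewrite gt_eqF.
by rewrite ler_wpM2r// mulr_ge0// divr_ge0// ltW.
Qed.

(** The second Bonferroni inequality; stating it without subtraction lets it
    cover sets of infinite measure. *)
Lemma bonferroni d (T : measurableType d) (R : realType) (mu : {measure set T -> \bar R})
    (E : nat -> set T) (m n : nat) : (forall i, measurable (E i)) ->
  (\sum_(m <= i < n) mu (E i) <=
   mu (\big[setU/set0]_(m <= i < n) E i) + \sum_(m <= i < n) \sum_(m <= j < i) mu (E j `&` E i))%E.
Proof.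
move=> mE; have mU k : measurable (\big[setU/set0]_(m <= i < k) E i) by exact: bigsetU_measurable.
elim: n => [|n IH]; first by rewrite !big_geq// measure0 adde0.
have [mn|nm] := leqP m n; last by rewrite !big_geq// measure0 adde0.
rewrite !big_nat_recr//=; set U := \big[setU/set0]_(_ <= i < n) E i in IH *.
have -> : (mu (U `|` E n) = mu U + mu (E n `\` U))%E.
  rewrite -measureU//.
  - by congr (mu _); apply/seteqP; split => x /=; have := pselect (U x); tauto.
  - exact: mU.
  - apply: measurableD => //; exact: mU.
  - by apply/seteqP; split => x //= [? []].
have -> : mu (E n) = (mu (E n `\` U) + mu (E n `&` U))%E by apply: measureDI => //; exact: mU.
have H : (mu (E n `&` U) <= \sum_(m <= j < n) mu (E j `&` E n))%E.
  have -> : U = \big[setU/set0]_(k < n - m) E (k + m)%N.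
    by rewrite /U -{1}[m]add0n big_addn big_mkord.
  rewrite -[X in index_iota X _]add0n big_addn big_mkord.
  pose F (k : nat) := E (k + m)%N `&` E n.
  apply: (@content_subadditive _ _ _ mu _ F).
  - by move=> k _; exact: measurableI.
  - by apply: measurableI => //; exact: bigsetU_measurable.
  - by rewrite setIC /F big_distrl.
rewrite [leRHS](_ : _ = (mu U + \sum_(m <= i < n) \sum_(m <= j < i) mu (E j `&` E i)) +
   (mu (E n `\` U) + \sum_(m <= j < n) mu (E j `&` E n)))%E.
  by apply: leeD => //; exact: leeD2l.
by rewrite -!addeA; congr (_ + _)%E; rewrite addeCA.
Qed.

(** Only the [p < q] with [q < K * p] enter the second term; for each of them
    [rho p <= K * eps / q], and there are at most [q] of them. *)
Lemma pair_sum_le (R : realType) (rho : nat -> R) (eps C0 C1 : R) (K m n : nat) :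
  (0 < m)%N -> 0 <= eps -> 0 <= C0 -> 0 <= C1 ->
  (forall q, (m <= q)%N -> 0 <= rho q /\ rho q * q%:R <= eps) ->
  \sum_(m <= q < n) \sum_(m <= p < q)
     (C0 * (rho p * rho q) + if (q < K * p)%N then C1 * (rho p * rho q) else 0) <=
  C0 * (\sum_(m <= q < n) rho q) ^+ 2 + C1 * (K%:R * eps) * \sum_(m <= q < n) rho q.
Proof.
move=> m0 e0 C00 C10 H.
set W := \sum_(m <= q < n) rho q.
rewrite expr2 mulrA -mulrDl mulr_sumr !big_nat; apply: ler_sum => q /andP[mq qn].
have [rq0 rqe] := H q mq.
have q0 : 0 < q%:R :> R by rewrite ltr0n (leq_trans m0).
rewrite big_split/= mulrDl; apply: lerD.
  rewrite -mulr_sumr -mulr_suml -mulrA ler_wpM2l// ler_wpM2r//.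
  rewrite /W (big_cat_nat mq (ltnW qn))/= lerDl big_nat sumr_ge0// => p /andP[qp _].
  by case: (H p (leq_trans mq qp)).
apply: (@le_trans _ _ (\sum_(m <= p < q) (C1 * (K%:R * eps) * rho q / q%:R))).
  rewrite !big_nat; apply: ler_sum => p /andP[mp pq]; have [rp0 rpe] := H p mp.
  case: ifP => [qKp|_]; last by rewrite divr_ge0 ?mulr_ge0// ltW.
  rewrite ler_pdivlMr// -!mulrA ler_wpM2l//.
  rewrite mulrCA [leRHS]mulrA [leRHS]mulrC ler_wpM2l//.
  apply: (@le_trans _ _ (rho p * (K * p)%:R)); first by rewrite ler_wpM2l// ler_nat ltnW.
  by rewrite natrM mulrCA ler_wpM2l.
rewrite sumr_const_nat -[leLHS]mulr_natl [leLHS]mulrC -[leLHS]mulrA ler_piMr//.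
  by rewrite !mulr_ge0.
by rewrite mulrC ler_pdivrMr// mul1r ler_nat leq_subr.
Qed.

(** * A fixed proportion of every box *)

(** Taking the minimum with [2^-(m+1)] makes neighbouring denominators cheap
    in the second moment; evaluating [psi] at the end of the block keeps the
    radius below [psi q] on the whole block. *)
Definition block_radius (R : realType) (psi : nat -> R) (m : nat) : R :=
  Num.min (psi (2 ^ m.+1)%N) (2 ^ m.+1)%:R^-1.

(** For non-increasing [psi], a point has infinitely many primitive solutions if
    and only if it belongs to these sets for all [N]. *)
Definition approximable (R : realType) (psi : nat -> R) (N : nat) : set (R * R) :=
  [set z | exists (q : nat) (p : int), [/\ (N <= q)%N, (0 < q)%N, coprimez p q &
    `|q%:R * z.1 + p%:~R - z.2| <= psi q]].

Lemma block_radius_ge0 (R : realType) (psi : nat -> R) m :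
  (forall l, (1 <= l)%N -> 0 < psi l) -> 0 <= block_radius psi m.
Proof. by move=> h; rewrite /block_radius le_min invr_ge0 ler0n andbT ltW// h// expn_gt0. Qed.

Lemma block_radius_weight (R : realType) (psi : nat -> R) m :
  (2 ^ m)%:R * block_radius psi m <= 1 / 2.
Proof.
apply: (@le_trans _ _ ((2 ^ m)%:R * (2 ^ m.+1)%:R^-1)).
  by rewrite ler_wpM2l// /block_radius ge_min lexx orbT.
have : 0 < (2 ^ m)%:R :> R by rewrite ltr0n expn_gt0.
rewrite expnS natrM => h; rewrite le_eqVlt; apply/orP; left; apply/eqP; field.
by rewrite gt_eqF.
Qed.

Lemma block_radius_le_inv (R : realType) (psi : nat -> R) q : (0 < q)%N ->
  block_radius psi (trunc_log 2 q) * q%:R <= 1.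
Proof.
move=> q0; have q0' : 0 < q%:R :> R by rewrite ltr0n.
rewrite -ler_pdivlMr// mul1r /block_radius ge_min; apply/orP; right.
by rewrite lef_pV2 ?posrE// ?ltr0n ?expn_gt0// ler_nat ltnW// trunc_log_ltn.
Qed.

Lemma block_radius_le_psi (R : realType) (psi : nat -> R) q :
  (forall k l : nat, (1 <= k)%N -> (k <= l)%N -> psi l <= psi k) -> (0 < q)%N ->
  block_radius psi (trunc_log 2 q) <= psi q.
Proof.
move=> h q0; rewrite /block_radius ge_min h//.
by rewrite ltnW// trunc_log_ltn.
Qed.

(** The second moment method.  What matters is that the proportion
    [1 / (64 * 2048)] depends neither on the box nor on [N]. *)
Lemma box_mass (R : realType) (psi : nat -> R) (a s b t : R) (N : nat) :
  (forall l : nat, (1 <= l)%N -> 0 < psi l) ->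
  (forall k l : nat, (1 <= k)%N -> (k <= l)%N -> psi l <= psi k) ->
  (forall m0 (B : R), exists m1, B <= \sum_(m0 <= m < m1) (2 ^ m)%:R * block_radius psi m) ->
  0 < s -> 0 < t ->
  exists E : set (measurableTypeR R * measurableTypeR R),
    [/\ measurable E, E `<=` `]a, a + s]%classic `*` `]b, b + t]%classic,
      E `<=` approximable psi N & ((s * t / (64 * 2048))%:E <= leb2 R E)%E].
Proof.
move=> psi0 psin Hdiv s0 t0.
have st0 : 0 < s * t by rewrite mulr_gt0.
(* The constant of [level_pair_near]. *)
pose C1 := 8 * (t + 3) * (s + 3).
have C10 : 0 < C1 by rewrite /C1 !mulr_gt0//; lra.
(* With this [K], [q' >= K * q] gives [6 * q <= t * (q' - q)], the hypothesis of
   [level_pair_far]. *)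
pose K := (Num.truncn (6 / t)).+2.
have K0 : 0 < K%:R :> R by rewrite ltr0n.
have HK : 6 <= t * (K%:R - 1).
  rewrite mulrC -ler_pdivrMr//.
  have := truncnS_gt (6 / t); rewrite /K -[_.+2%:R]natr1; lra.
(* The target for the sum [W] of the radii: the far pairs cost
   [32 * (s * t) * W ^+ 2], a quarter of the first moment [s * t / 16 * W] when
   [W = 1 / 2048]. *)
pose dl : R := 1 / 2048.
(* Below [e2] the near pairs cost at most [s * t / 64 * W], another quarter. *)
pose e2 := s * t / (64 * C1 * K%:R).
have e20 : 0 < e2.
  by rewrite /e2 divr_gt0// mulr_gt0// mulr_gt0//; lra.
pose eps := Num.min dl (Num.min e2 (t / 8)).
have dl0 : 0 < dl by rewrite /dl; lra.
have eps0 : 0 < eps by rewrite /eps !lt_min e20 dl0/=; lra.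
have eps_dl : eps <= dl by rewrite /eps ge_min lexx.
have eps_e2 : eps <= e2 by rewrite /eps !ge_min lexx orbT.
have eps_t : eps <= t / 8 by rewrite /eps !ge_min lexx !orbT.
have epsK : C1 * (K%:R * eps) <= s * t / 64.
  apply: (@le_trans _ _ (C1 * (K%:R * e2))).
    by rewrite ler_wpM2l ?(ltW C10)// ler_wpM2l// ltW.
  by rewrite /e2 le_eqVlt; apply/orP; left; apply/eqP; field; rewrite !gt_eqF.
have [mm Hmm] := @coprime_count_eventually R s (t / 2) s0 (ltac:(lra)).
pose m0 := maxn mm N.
pose r := block_radius psi.
have r0 m : 0 <= r m by exact: block_radius_ge0.
have rw m : (2 ^ m)%:R * r m <= 1 / 2 by exact: block_radius_weight.
have r1 m : r m <= 1 / 2.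
  by apply: le_trans (rw m); rewrite ler_peMl// ler1n expn_gt0.
have er m : 0 <= eps * r m <= eps / 2.
  have : eps * r m <= eps * (1 / 2) by rewrite ler_wpM2l// ltW.
  have : 0 <= eps * r m by rewrite mulr_ge0// ltW.
  move=> *; apply/andP; split; lra.
pose W m1 := eps * \sum_(m0 <= m < m1) (2 ^ m)%:R * r m.
have exW : exists n, dl / 2 <= W n.
  have [n Hn] := Hdiv m0 (dl / 2 / eps); exists n.
  by rewrite /W [leRHS]mulrC -ler_pdivrMr.
(* Stop at the first block where the target is half reached; a single block
   adds at most [eps / 2], so the target is not exceeded. *)
case: (ex_minnP exW) => m1 Wm1 minm1.
have m01 : (m0 < m1)%N.
  by rewrite ltnNge; apply/negP => m10; move: Wm1; rewrite /W big_geq// mulr0 /dl; lra.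
have WE : W m1 = \sum_(2 ^ m0 <= q < 2 ^ m1) eps * r (trunc_log 2 q).
  rewrite sum_dyadic 1?ltnW// /W mulr_sumr; apply: eq_bigr => m _.
  rewrite (eq_bigr (fun=> eps * r m)); last by move=> j _; rewrite trunc_log2_block.
  by rewrite sumr_const card_ord -[RHS]mulr_natl mulrCA.
have Wdl : W m1 <= dl.
  case: m1 Wm1 minm1 m01 {WE} => // n Wm1 minm1; rewrite ltnS => m0n.
  have Wn : W n < dl / 2.
    by rewrite ltNge; apply/negP => /minm1; rewrite ltnn.
  rewrite /W big_nat_recr//= mulrDr -/(W n).
  have : eps * ((2 ^ n)%:R * r n) <= eps * (1 / 2) by rewrite ler_wpM2l// ltW.
  lra.
pose rho q := eps * r (trunc_log 2 q).
pose E q := level a s b t (rho q) q.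
have rho_half q : 0 <= rho q <= 1 / 2.
  have /andP[h1 h2] := er (trunc_log 2 q); rewrite /rho h1/= (le_trans h2)//.
  by move: eps_dl; rewrite /dl; lra.
have rho_t q : rho q <= t / 8.
  have /andP[h1 h2] := er (trunc_log 2 q); rewrite /rho (le_trans h2)//; lra.
have qpos q : (2 ^ m0 <= q)%N -> (0 < q)%N by apply: leq_trans; rewrite expn_gt0.
have qm0 q : (2 ^ m0 <= q)%N -> (m0 <= trunc_log 2 q)%N by exact: trunc_log_max.
have big q : (2 ^ m0 <= q)%N -> t / 2 <= s * (2 ^ trunc_log 2 q)%:R.
  move=> /qm0 h; have [|+ _] := Hmm (trunc_log 2 q) (fun=> 0).
    by rewrite (leq_trans _ h)// leq_maxl.
  by move=> kle; rewrite -subr_ge0; apply: le_trans kle.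
set U := \big[setU/set0]_(2 ^ m0 <= q < 2 ^ m1) E q.
have Uinv z : U z -> exists2 q, (2 ^ m0 <= q)%N & E q z.
  by rewrite /U big_nat_cond -bigcup_seq_cond => -[q /= /andP[_ /andP[/andP[h _] _]]] Eq; exists q.
exists U; split.
- by apply: bigsetU_measurable => q _; exact: measurable_level.
- move=> z /Uinv[q qm Eq].
  by have := level_box (qpos _ qm) s0 t0 (rho_t q) (big q qm) Eq; rewrite /= !in_itv/=.
- move=> z /Uinv[q qm /level_inv[i [_ cp [_ Hz]]]].
  exists q, (window_start a s b t q + i%:Z); split => //.
  + apply: leq_trans qm; apply: (@leq_trans (2 ^ N)%N); first by rewrite ltnW// ltn_expl.
    by rewrite leq_exp2l// leq_maxr.
  + exact: qpos.
  + apply: (le_trans Hz); apply: le_trans (block_radius_le_psi psin (qpos _ qm)).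
    by rewrite /rho ler_piMl//; move: eps_dl; rewrite /dl; lra.
have F1 : ((s * t / 16 * W m1)%:E <= \sum_(2 ^ m0 <= q < 2 ^ m1) leb2 R (E q))%E.
  apply: first_moment => //; [exact: ltW|exact: ltnW| |].
  - move=> m _; have /andP[_] := er m; move: eps_dl; rewrite /dl; lra.
  - by move=> m z kap m0m; have [|] := Hmm m z => //; rewrite (leq_trans _ m0m)// leq_maxl.
have F2 := @bonferroni _ _ R (leb2 R) E (2 ^ m0) (2 ^ m1) (fun q => measurable_level a s b t (rho q) q).
have F3 : (\sum_(2 ^ m0 <= q < 2 ^ m1) \sum_(2 ^ m0 <= p < q) leb2 R (E p `&` E q) <=
  (32 * (s * t) * W m1 ^+ 2 + C1 * (K%:R * eps) * W m1)%:E)%E.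
  rewrite WE; apply: (@le_trans _ _ (\sum_(2 ^ m0 <= q < 2 ^ m1) \sum_(2 ^ m0 <= p < q)
     (32 * (s * t) * (rho p * rho q) + if (q < K * p)%N then C1 * (rho p * rho q) else 0))%:E).
    rewrite -sumEFin !big_nat; apply: lee_sum => q /andP[qm _].
    rewrite -sumEFin !big_nat; apply: lee_sum => p /andP[pm pq].
    have rr : 0 <= rho p * rho q.
      by have /andP[? _] := rho_half p; have /andP[? _] := rho_half q; rewrite mulr_ge0.
    have pq' : (0 < p < q)%N by rewrite pq qpos.
    case: ifPn => qKp.
      apply: (le_trans (level_pair_near _ _ pq' s0 t0 (rho_half p) (rho_half q) (rho_t p) (big p pm))).
      by rewrite lee_fin lerDr mulr_ge0// mulr_ge0// ltW.
    rewrite addr0; apply: (level_pair_far _ _ pq' s0 t0 (rho_half p) (rho_half q) (big p pm)).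
    rewrite natrB ?(ltnW pq)//.
    have : (K * p)%:R <= q%:R :> R by rewrite ler_nat leqNgt.
    rewrite natrM => h.
    have : t * (K%:R * p%:R) <= t * q%:R by rewrite ler_wpM2l// ltW.
    have : 6 * p%:R <= t * (K%:R - 1) * p%:R by rewrite ler_wpM2r.
    lra.
  rewrite lee_fin; apply: pair_sum_le => //.
  - by rewrite expn_gt0.
  - exact: ltW.
  - by rewrite mulr_ge0// ltW.
  - exact: ltW.
  move=> q qm; split; first by case/andP: (rho_half q).
  rewrite /rho -mulrA ler_piMr ?(ltW eps0)//; apply: block_radius_le_inv; exact: qpos.
have {}F3 := le_trans F1 (le_trans F2 (leeD2l _ F3)).
move: F3; rewrite -leeBlDr// -EFinB; apply: le_trans; rewrite lee_fin.
have W0 : 0 < W m1 by apply: lt_le_trans Wm1; rewrite /dl; lra.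
have H1 : C1 * (K%:R * eps) * W m1 <= s * t / 64 * W m1 by rewrite ler_wpM2r// ltW.
have H2 : 32 * (s * t) * W m1 ^+ 2 <= 32 * (s * t) * (W m1 * dl).
  apply: ler_wpM2l; first by rewrite mulr_ge0// ltW.
  by rewrite expr2; apply: ler_wpM2l => //; exact: ltW.
have H3 : s * t * (dl / 2) <= s * t * W m1 by rewrite ler_wpM2l// ltW.
move: H1 H2 H3; rewrite /dl; lra.
Qed.

(** If the minimum defining the radius is infinitely often [2^-(m+1)], the
    weights are infinitely often [1 / 2].  Otherwise it is eventually
    [psi (2^(m+1))], and Cauchy condensation applies. *)
Lemma block_weights_diverge (R : realType) (psi : nat -> R) :
  (forall l : nat, (1 <= l)%N -> 0 < psi l) ->
  (forall k l : nat, (1 <= k)%N -> (k <= l)%N -> psi l <= psi k) ->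
  \sum_(1 <= l < n.+1) psi l @[n --> \oo] --> +oo ->
  forall m0 (B : R), exists m1, B <= \sum_(m0 <= m < m1) (2 ^ m)%:R * block_radius psi m.
Proof.
move=> psi0 psin div m0 B.
pose f m := (2 ^ m)%:R * block_radius psi m.
have f0 m : 0 <= f m by rewrite mulr_ge0// block_radius_ge0.
have fsum0 i j : 0 <= \sum_(i <= m < j) f m by exact: sumr_ge0.
have psum0 i j : (1 <= i)%N -> 0 <= \sum_(i <= m < j) psi m.
  by move=> i1; rewrite big_nat sumr_ge0// => k /andP[ik _]; rewrite ltW// psi0// (leq_trans i1).
have [often|/existsNP[M HM]] := pselect (forall M, exists2 m, (M <= m)%N & 1 / 2 <= f m).
  have H k : exists2 n, (m0 <= n)%N & k%:R / 2 <= \sum_(m0 <= m < n) f m.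
    elim: k => [|k [n m0n Hn]]; first by exists m0 => //; rewrite mul0r.
    have [m nm Hm] := often n; exists m.+1; first by rewrite leqW// (leq_trans m0n).
    rewrite big_nat_recr ?(leq_trans m0n)//= (@big_cat_nat _ _ _ n)//=.
    by have := fsum0 n m; rewrite -natr1; lra.
  have [n _ Hn] := H (Num.truncn (2 * B)).+1; exists n; apply: le_trans Hn.
  by rewrite ler_pdivlMr// mulrC ltW// truncnS_gt.
have rE m : (M <= m)%N -> f m = (2 ^ m)%:R * psi (2 ^ m.+1)%N.
  move=> Mm; rewrite /f /block_radius /Num.min; case: ifP => // /negbT h.
  exfalso; apply: HM; exists m => //; rewrite /f /block_radius /Num.min (negbTE h).
  have : 0 < (2 ^ m)%:R :> R by rewrite ltr0n expn_gt0.
  rewrite expnS natrM => h'; rewrite le_eqVlt; apply/orP; left; apply/eqP; field.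
  by rewrite gt_eqF.
pose M' := maxn M m0.
have lower n : (M' <= n)%N -> \sum_(2 ^ M'.+1 <= l < 2 ^ n.+1) psi l <= 2 * \sum_(M' <= m < n) f m.
  move=> M'n; rewrite sum_dyadic// big_add1/= mulr_sumr !big_nat; apply: ler_sum => m /andP[M'm _].
  rewrite rE; last by rewrite (leq_trans _ M'm)// leq_maxl.
  rewrite mulrA -natrM -expnS.
  apply: (@le_trans _ _ (\sum_(j < 2 ^ m.+1) psi (2 ^ m.+1)%N)).
    by apply: ler_sum => j _; rewrite psin ?expn_gt0// leq_addr.
  by rewrite sumr_const card_ord -[leLHS]mulr_natl.
have := (cvgryPge _).1 div (2 * B + \sum_(1 <= l < 2 ^ M'.+1) psi l).
move=> [N0 _ /(_ N0 (leqnn _)) HN0].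
pose n := maxn N0 M'; exists n.
have M'n : (M' <= n)%N by exact: leq_maxr.
have N0n : (N0.+1 <= 2 ^ n.+1)%N.
  by rewrite (leq_trans (ltn_expl N0 (ltnSn 1)))// leq_exp2l// leqW// leq_maxl.
have e1 : (1 <= 2 ^ M'.+1)%N by rewrite expn_gt0.
have e2 : (2 ^ M'.+1 <= 2 ^ n.+1)%N by rewrite leq_exp2l.
have s1 : \sum_(1 <= l < 2 ^ n.+1) psi l = \sum_(1 <= l < N0.+1) psi l + \sum_(N0.+1 <= l < 2 ^ n.+1) psi l.
  by rewrite (@big_cat_nat _ _ _ N0.+1).
have s2 : \sum_(1 <= l < 2 ^ n.+1) psi l = \sum_(1 <= l < 2 ^ M'.+1) psi l + \sum_(2 ^ M'.+1 <= l < 2 ^ n.+1) psi l.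
  by rewrite (@big_cat_nat _ _ _ (2 ^ M'.+1)).
have s3 : \sum_(m0 <= m < n) f m = \sum_(m0 <= m < M') f m + \sum_(M' <= m < n) f m.
  by rewrite (@big_cat_nat _ _ _ M')// leq_maxr.
rewrite -/(f _) s3.
have := lower n M'n; have := psum0 N0.+1 (2 ^ n.+1)%N isT; have := fsum0 m0 M'.
move: HN0; rewrite /=; lra.
Qed.

(** * Convergence and divergence *)

Lemma measurable_near_line (R : realType) q (rho : R) :
  measurable (near_line q rho : set (measurableTypeR R * measurableTypeR R)).
Proof.
rewrite (_ : near_line q rho = \bigcup_(p in [set: int])
   [set z | q%:R * z.1 + (- 1) * z.2 + p%:~R \in `[- rho, rho]]).
  by apply: countable_bigcupT_measurable => // p; exact: measurable_affine_itv.
apply/seteqP; split => [z [p h]|z [p _ h]]; exists p => //; move: h;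
  by rewrite /= in_itv/= -ler_norml mulN1r addrAC.
Qed.

Lemma measurable_approximable (R : realType) (psi : nat -> R) N :
  measurable (approximable psi N : set (measurableTypeR R * measurableTypeR R)).
Proof.
pose F (v : nat * int) : set (measurableTypeR R * measurableTypeR R) :=
  if [&& (N <= v.1)%N, (0 < v.1)%N & coprimez v.2 v.1] then
   [set z | v.1%:R * z.1 + (- 1) * z.2 + v.2%:~R \in `[- psi v.1, psi v.1]] else set0.
rewrite (_ : approximable psi N = \bigcup_(v in [set: nat * int]) F v).
  apply: countable_bigcupT_measurable => // v; rewrite /F; case: ifP => // _.
  exact: measurable_affine_itv.
apply/seteqP; split => z.
  move=> [q [p [h1 h2 h3 h4]]]; exists (q, p) => //; rewrite /F/= h1 h2 h3/= in_itv/=.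
  by move: h4; rewrite ler_norml mulN1r addrAC.
move=> [[q p] _]; rewrite /F/=; case: ifPn => // /and3P[h1 h2 h3] h4; exists q, p; split => //.
by move: h4; rewrite /= in_itv/= mulN1r addrAC -ler_norml.
Qed.

Lemma leb2_box (R : realType) (a b s t : R) : 0 <= s -> 0 <= t ->
  leb2 R (`]a, a + s]%classic `*` `]b, b + t]%classic) = (s * t)%:E.
Proof.
move=> s0 t0; have -> : (s * t)%:E = (leb R `]a, (a + s)%R]%classic * leb R `]b, (b + t)%R]%classic)%E.
  rewrite !lebesgue_itvoc ?lerDl// -EFinM; congr _%:E; ring.
by rewrite product_measure1E//; exact: measurable_leb_itv.
Qed.

(** By [box_mass] the complement has proportion at most [1 - 1 / (64 * 2048)]
    in every box, and the density criterion applies. *)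
Lemma approximable_full (R : realType) (psi : nat -> R) N :
  (forall l : nat, (1 <= l)%N -> 0 < psi l) ->
  (forall k l : nat, (1 <= k)%N -> (k <= l)%N -> psi l <= psi k) ->
  \sum_(1 <= l < n.+1) psi l @[n --> \oo] --> +oo ->
  leb2 R (~` approximable psi N) = 0%E.
Proof.
move=> psi0 psin div.
apply: (@leb2_null_density R _ (1 - 1 / (64 * 2048))); first by lra.
  by apply: measurableC; exact: measurable_approximable.
move=> a a' b b' aa' bb'.
have s0 : 0 < a' - a by rewrite subr_gt0.
have t0 : 0 < b' - b by rewrite subr_gt0.
have [E [mE Ebox Eapp Elow]] := box_mass a b N psi0 psin (block_weights_diverge psi0 psin div) s0 t0.
move: Ebox Elow; rewrite !subrKC => Ebox Elow.
set B := `]a, a']%classic `*` `]b, b']%classic in Ebox *.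
have mB : measurable (B : set (measurableTypeR R * measurableTypeR R)).
  by apply: measurableX; exact: measurable_leb_itv.
have Bfin : leb2 R B = ((a' - a) * (b' - b))%:E.
  by rewrite -(leb2_box a b (ltW s0) (ltW t0)) !subrKC.
apply: (@le_trans _ _ (leb2 R (B `\` E))).
  apply: le_measure; rewrite ?inE.
  - by apply: measurableI => //; apply: measurableC; exact: measurable_approximable.
  - exact: measurableD.
  - by move=> z [h1 h2]; split => // /Eapp.
have Bltoo : (leb2 R B < +oo)%E by rewrite Bfin ltry.
rewrite measureD//.
rewrite (_ : B `&` E = E); last by rewrite setIC; apply/setIidPl.
rewrite leeBlDr; last first.
  rewrite ge0_fin_numE ?measure_ge0//; apply: (@le_lt_trans _ _ (leb2 R B)).
    by apply: le_measure; rewrite ?inE.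
  exact: Bltoo.
apply: le_trans (leeD2l _ Elow); apply: (@le_trans _ _ (leb2 R B)) => //.
rewrite Bfin -EFinD lee_fin; lra.
Qed.

Lemma large_denominators_infinite (R : realType) (psi : nat -> R) (z : R * R) :
  (forall N, approximable psi N z) -> infinite_set (primitive_solutions psi z.1 z.2).
Proof.
move=> H fin.
have /finite_seqP[s sE] := fin.
pose N := (\max_(v <- s) `|v.2|).+1%N.
have [q [p [Nq q0 cp Hz]]] := H N.
have : primitive_solutions psi z.1 z.2 (p, q%:Z).
  split; first by apply/eqP.
  by split => //=.
rewrite sE /= => pqs.
have := @leq_bigmax_seq _ s xpredT (fun v : int * int => `|v.2|%N) _ pqs isT.
by rewrite /= leqNgt Nq.
Qed.

(** The solutions with [q < N] lie in a finite box, since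
    [|p| <= psi 1 + |y| + N |xi|] for them. *)
Lemma infinite_large_denominators (R : realType) (psi : nat -> R) (z : R * R) N :
  (forall k l : nat, (1 <= k)%N -> (k <= l)%N -> psi l <= psi k) ->
  infinite_set (primitive_solutions psi z.1 z.2) -> approximable psi N z.
Proof.
move=> psin; apply: contra_notP => nN.
pose M := Num.truncn (psi 1%N + `|z.2| + N%:R * `|z.1|).
pose g (ij : nat * nat) : int * int := (ij.1%:Z - M%:Z, ij.2%:Z).
apply: (@sub_finite_set _ _ (g @` (`I_(2 * M + 1) `*` `I_N))); last first.
  by apply: finite_image; apply: finite_setX; exact: finite_II.
move=> [p q] [/= /eqP cp [q1 Hz]].
have qE : q = `|q|%N%:Z by rewrite gez0_abs//; lia.
have qN : (`|q| < N)%N.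
  rewrite ltnNge; apply/negP => Nq; apply: nN; exists `|q|%N, p; split => //.
  - lia.
  - by move: Hz; rewrite {1}qE.
have psi1 : psi `|q|%N <= psi 1%N by rewrite psin//; lia.
have bound : `|p|%N%:R <= psi 1%N + `|z.2| + N%:R * `|z.1|.
  rewrite -[leLHS]/((Posz _)%:~R) abszE intr_norm.
  rewrite (_ : p%:~R = (q%:~R * z.1 + p%:~R - z.2) + z.2 + - (q%:~R * z.1)); last by ring.
  apply: (le_trans (ler_normD _ _)); rewrite normrN; apply: lerD.
    apply: (le_trans (ler_normD _ _)); rewrite lerD2r; exact: le_trans psi1.
  rewrite normrM ler_wpM2r// {1}qE ger0_norm// ler_nat; exact: ltnW.
have pM : (`|p| <= M)%N.
  by rewrite truncn_ge_nat// (le_trans _ bound).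
exists (absz (p + M%:Z), `|q|%N); first by split => /=; lia.
rewrite /g/=; congr pair; lia.
Qed.

Lemma near_box_le (R : realType) (rho : R) (q n : nat) : 0 <= rho <= 1 ->
  (leb2 R (near_line q rho `&` (`](- n%:R)%R, n%:R]%classic `*` `](- n%:R)%R, n%:R]%classic))
    <= ((2 * n%:R + 3) * (2 * rho) * (2 * n%:R))%:E)%E.
Proof.
move=> rho01; have n0 : 0 <= n%:R :> R by [].
set I : set (measurableTypeR R) := `](- n%:R)%R, n%:R]%classic.
have mI : measurable I by exact: measurable_leb_itv.
have leI : leb R I = (2 * n%:R)%:E.
  by rewrite lebesgue_itvoc; [congr _%:E; ring|rewrite -subr_ge0 opprK addr_ge0].
rewrite EFinM -leI.
have mS : measurable (near_line q rho `&` (I `*` I) : set (measurableTypeR R * measurableTypeR R)).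
  by apply: measurableI; [exact: measurable_near_line|exact: measurableX].
apply: leb2_le_sections => //.
  by case/andP: rho01 => *; rewrite !mulr_ge0// addr_ge0// mulr_ge0.
move=> x; have [xI|xI] := boolP (x \in I); last first.
  rewrite indicE (negbTE xI) mulr0 (_ : xsection _ x = set0) ?measure0//.
  apply/seteqP; split => y //; rewrite /xsection/= inE => -[_ [/= h _]].
  by case/negP: xI; rewrite inE.
rewrite indicE xI mulr1; apply: (@near_line_section_le _ _ q _ (- n%:R) (2 * n%:R)) => //.
move=> y [h [_ /=]]; rewrite /I/= in_itv/= => /andP[h1 h2]; split => //.
by rewrite (ltW h1)/=; lra.
Qed.

Lemma convergence_negligible (R : realType) (psi : nat -> R) :
  (forall l : nat, (1 <= l)%N -> 0 < psi l) ->
  (forall k l : nat, (1 <= k)%N -> (k <= l)%N -> psi l <= psi k) ->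
  psi l @[l --> \oo] --> (0 : R) ->
  cvg (\sum_(1 <= l < n.+1) psi l @[n --> \oo]) ->
  (leb2 R).-negligible [set z : R * R | infinite_set (primitive_solutions psi z.1 z.2)].
Proof.
move=> psi0 psin cvg0 cv.
have [q0 Hq0] : exists q0, forall q, (q0 <= q)%N -> psi q <= 1.
  have := (cvgr0Pnorm_le _).1 cvg0 1 ltr01 => -[q0 _ H].
  by exists q0 => q /H/= ; apply: le_trans; rewrite ler_norm.
pose I n : set (measurableTypeR R) := `](- n%:R)%R, n%:R]%classic.
pose F n q : set (measurableTypeR R * measurableTypeR R) :=
  if (maxn q0 1 <= q)%N then near_line q (psi q) `&` (I n `*` I n) else set0.
have mI n : measurable (I n) by exact: measurable_leb_itv.
have mF n q : measurable (F n q).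
  rewrite /F; case: ifP => // _.
  by apply: measurableI; [exact: measurable_near_line|exact: measurableX].
have limsup0 n : leb2 R (lim_sup_set (F n)) = 0%E.
  apply: lim_sup_set_cvg0 => //.
  pose C : R := (2 * n%:R + 3) * 2 * (2 * n%:R).
  have C0 : 0 <= C by rewrite /C !mulr_ge0// addr_ge0// mulr_ge0.
  pose S := limn (fun n => \sum_(1 <= l < n.+1) psi l).
  have SS k : \sum_(1 <= l < k.+1) psi l <= S.
    apply: (nondecreasing_cvgn_le _ cv) => i j ij.
    rewrite [leRHS](@big_cat_nat _ _ _ i.+1)//= lerDl big_nat sumr_ge0// => l /andP[il _].
    by rewrite ltW// psi0// (leq_trans _ il).
  apply: (@le_lt_trans _ _ (C * S)%:E); last exact: ltry.
  apply: lime_le; first exact: is_cvg_nneseries.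
  apply: nearW => k.
  apply: (@le_trans _ _ (\sum_(0 <= q < k.+1) (if (1 <= q)%N then C * psi q else 0)%:E)%E).
    rewrite big_nat_recr//= -[leLHS]adde0; apply: leeD; last first.
      by rewrite lee_fin; case: ifP => // k1; rewrite mulr_ge0// ltW// psi0.
    apply: lee_sum => q _; rewrite /F geq_max; case: ifP => [/andP[h1 h2]|_].
      rewrite h2; apply: (le_trans (near_box_le _ _ _)).
        by rewrite ltW ?psi0//= Hq0.
      by rewrite lee_fin /C le_eqVlt; apply/orP; left; apply/eqP; ring.
    by rewrite measure0 lee_fin; case: ifP => // k1; rewrite mulr_ge0// ltW// psi0.
  rewrite sumEFin lee_fin big_ltn//= add0r big_nat.
  rewrite (eq_bigr (fun q => C * psi q)); last by move=> q /andP[-> _].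
  by rewrite -big_nat -mulr_sumr ler_wpM2l.
apply: (@negligibleS _ _ _ (leb2 R) (\bigcup_n lim_sup_set (F n))); last first.
  apply: negligible_bigcup => n; apply/negligibleP; last exact: limsup0.
  by apply: bigcap_measurable => // k _; apply: bigcup_measurable.
move=> z /= zinf.
pose n := maxn (Num.bound z.1) (Num.bound z.2).
have zI x : x = z.1 \/ x = z.2 -> I n x.
  move=> xz; rewrite /I/= in_itv/=.
  have : `|x| < n%:R.
    by case: xz => ->; apply: (lt_le_trans (unstable.ltr_norm_bound _)); rewrite ler_nat /n ?leq_maxl ?leq_maxr.
  by rewrite ltr_norml => /andP[-> /ltW].
exists n => //= k _.
have [q [p [Nq q1 cp Hz]]] := infinite_large_denominators (maxn k (maxn q0 1)) psin zinf.
exists q; first by rewrite /= (leq_trans _ Nq)// leq_maxl.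
rewrite /F (leq_trans _ Nq) ?leq_maxr//; split; first by exists p.
by split => /=; apply: zI; [left|right].
Qed.

Theorem theorem2 (R : realType) (psi : nat -> R)
  (psi_gt0 : forall l : nat, (1 <= l)%N -> 0 < psi l)
  (psi_noninc : forall k l : nat, (1 <= k)%N -> (k <= l)%N -> psi l <= psi k)
  (psi_cvg0 : psi l @[l --> \oo] --> (0 : R))
  (psi_dil : forall c : nat, (1 <= c)%N ->
    exists c1 c2 : R, 0 < c1 /\ c1 < c2 /\
      forall l : nat, (1 <= l)%N ->
        c1 * psi l <= psi (c * l)%N /\ psi (c * l)%N <= c2 * psi l) :
  (\sum_(1 <= l < n.+1) psi l @[n --> \oo] --> +oo ->
    {ae (@lebesgue_measure R \x @lebesgue_measure R)%E, forall z : R * R,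
      infinite_set (primitive_solutions psi z.1 z.2)})
  /\
  (cvg (\sum_(1 <= l < n.+1) psi l @[n --> \oo]) ->
    (@lebesgue_measure R \x @lebesgue_measure R)%E.-negligible
      [set z : R * R | infinite_set (primitive_solutions psi z.1 z.2)]).
Proof.
split; last exact: convergence_negligible.
move=> div.
apply: (@negligibleS _ _ _ (leb2 R) (\bigcup_N ~` approximable psi N)).
  move=> z /= nz; apply: contrapT => nN; apply: nz; apply: large_denominators_infinite => N.
  by apply: contrapT => nNz; apply: nN; exists N.
apply: negligible_bigcup => N; apply/negligibleP; last exact: approximable_full.
by apply: measurableC; exact: measurable_approximable.
Qed.
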